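(* Let $\Pi \subset \mathbb{R}^2$ be a closed circular sector of central angle $30^\circ$ and radius $1$, for example $\Pi = \{(r\cos t, r\sin t) : 0 \le r \le 1,\ 0 \le t \le \pi/6\}$. Then $\Pi$ contains a congruent copy of every unit arc in the plane; that is, for every arc $\gamma$ in $\mathbb{R}^2$ of length $1$ there is an isometry $T$ of $\mathbb{R}^2$ such that $T(\gamma) \subseteq \Pi$.
   Context: An arc in the plane is the image of a continuous rectifiable map $\gamma : [0,1] \to \mathbb{R}^2$, and it is a unit arc if the length (total variation) of $\gamma$ equals $1$. A congruent copy of a planar set is its image under an isometry (rigid motion, reflections allowed) of $\mathbb{R}^2$. *)

(* Defs.v *)
From HB Require Import structures.
From mathcomp Require Import all_boot all_order all_algebra.
From mathcomp Require Import all_classical all_reals all_analysis.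

Set Implicit Arguments.
Unset Strict Implicit.
Unset Printing Implicit Defensive.

Import Order.TTheory GRing.Theory Num.Theory.
Import numFieldNormedType.Exports.

Local Open Scope classical_set_scope.
Local Open Scope ring_scope.

(* The plane is [R * R].  Its canonical norm in the library is the max norm,
   which induces the usual topology but not the Euclidean lengths; hence the
   explicit Euclidean distance. *)
Definition eucl_dist (R : realType) (p q : R * R) : R :=
  Num.sqrt ((p.1 - q.1) ^+ 2 + (p.2 - q.2) ^+ 2).

(* [s] lists the points of a subdivision of `[a, b] without its origin [a], as
   in [itv_partition]; these definitions mirror [variation], [variations] and
   [total_variation] for plane-valued functions. *)
Definition curve_variation (R : realType) (a b : R) (f : R -> R * R)
    (s : seq R) : R :=
  let F := f \o nth b (a :: s) in
  \sum_(0 <= n < size s) eucl_dist (F n.+1) (F n).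

Definition curve_variations (R : realType) (a b : R) (f : R -> R * R) : set R :=
  [set curve_variation a b f s | s in itv_partition a b].

Definition curve_length (R : realType) (a b : R) (f : R -> R * R) : \bar R :=
  ereal_sup [set x%:E | x in curve_variations a b f].

(* [gamma] need not be injective; only its values on `[0, 1] matter. *)
Definition unit_arc (R : realType) (A : set (R * R)) : Prop :=
  exists gamma : R -> R * R,
    [/\ {within `[0, 1], continuous gamma},
        curve_length 0 1 gamma = 1%:E &
        A = gamma @` `[0, 1]].

Definition plane_isometry (R : realType) (T : R * R -> R * R) : Prop :=
  forall p q, eucl_dist (T p) (T q) = eucl_dist p q.

(* Closed sector with apex [c], radius [r] and central angle [alpha], whose
   sides point in the directions of polar angles [theta] and [theta + alpha]. *)
Definition sector (R : realType) (c : R * R) (theta alpha r : R) :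
    set (R * R) :=
  [set p | exists rho t : R,
    [/\ 0 <= rho <= r, 0 <= t <= alpha &
        p = (c.1 + rho * cos (theta + t), c.2 + rho * sin (theta + t))]].

(* Main.v *)
(* By compactness of the set of placements it is enough to treat the finitely many
   points of a subdivision, visited in order by a polygonal path of length L <= 1.

   Among the paths through some of these points with the same convex hull, choose
   one of minimal length, then of minimal size.  Its vertices are strictly extreme
   (otherwise drop one) and 2-opt moves do not shorten it, so by the crossing
   argument there are no four vertices in cyclic order around the hull whose times
   on the path are alternately lower and higher.

   Compare the times of the vertices extreme in directions f and f + 150 degrees.
   Twelve such steps make five full turns, so the sign of the comparison changes at
   some f.  This yields either a vertex extreme in both directions, at which the
   wedge of angle 30 degrees fits trivially, or a circumscribed wedge of angle 30
   degrees with apex P1 met by the path at A on its first side, then B on the second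
   one, then A' on the first one further from P1.  The reversed path gives another
   wedge, with apex P2 and contacts C', D, C, so that the path meets C, D, C' in this
   order.

   If |P1 A| <= |P2 C'|, then every vertex is within L of P1, except when both wedges
   lean on the same side of the hull and are mirror images; in that case no two
   vertices X1, X2 satisfy |P1 X1| > L and |P2 X2| > L simultaneously.  These
   estimates come from unfolding the path by reflection in the side of a wedge, that
   is from comparing distances to A with distances to its image under the rotation by
   60 degrees about the apex, after the non-alternation property has left only a few
   possible orders for A, B, A', C, D, C' on the path. *)
Require Import Defs.
From HB Require Import structures.
From mathcomp Require Import all_boot all_order all_algebra.
From mathcomp Require Import all_classical all_reals all_analysis.
From mathcomp Require Import ring lra.

Set Implicit Arguments.
Unset Strict Implicit.
Unset Printing Implicit Defensive.

Import Order.TTheory GRing.Theory Num.Theory.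
Import numFieldNormedType.Exports.

Local Open Scope ring_scope.

(** * The Euclidean norm in coordinates *)

Definition norm2 (R : rcfType) (x y : R) : R := Num.sqrt (x ^+ 2 + y ^+ 2).

(** Certificate form of an inequality: once a nonnegative [z] is named, only an identity remains,
    left to [ring] or [field] modulo [r3 ^+ 2 = 3]. *)
Lemma le_subE (R : numDomainType) (u v z : R) : 0 <= z -> v - u = z -> u <= v.
Proof. by move=> z0 e; rewrite -subr_ge0 e. Qed.

Section Norm2.
Variable R : rcfType.
Implicit Types x y u v c s m a : R.

Lemma norm2_ge0 x y : 0 <= norm2 x y.
Proof. exact: sqrtr_ge0. Qed.

Lemma norm2_sq x y : norm2 x y ^+ 2 = x ^+ 2 + y ^+ 2.
Proof. by rewrite sqr_sqrtr // addr_ge0 // sqr_ge0. Qed.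

Lemma norm2_eq x y u v : x ^+ 2 + y ^+ 2 = u ^+ 2 + v ^+ 2 ->
  norm2 x y = norm2 u v.
Proof. by rewrite /norm2 => ->. Qed.

Lemma norm2_mono x y u v : x ^+ 2 + y ^+ 2 <= u ^+ 2 + v ^+ 2 ->
  norm2 x y <= norm2 u v.
Proof. by move=> h; rewrite ler_sqrt // addr_ge0 // sqr_ge0. Qed.

Lemma norm2_le x y m : 0 <= m -> x ^+ 2 + y ^+ 2 <= m ^+ 2 -> norm2 x y <= m.
Proof. by move=> m0 h; rewrite -(ger0_norm m0) -sqrtr_sqr ler_sqrt // sqr_ge0. Qed.

Lemma norm2_ge x y m : m ^+ 2 <= x ^+ 2 + y ^+ 2 -> m <= norm2 x y.
Proof.
move=> h; apply: (le_trans (ler_norm m)); rewrite -sqrtr_sqr ler_sqrt //.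
by rewrite addr_ge0 // sqr_ge0.
Qed.

Lemma norm2N x y : norm2 (- x) (- y) = norm2 x y.
Proof. by apply: norm2_eq; ring. Qed.

Lemma norm2_dot x y u v : x * u + y * v <= norm2 x y * norm2 u v.
Proof.
have h : (x * u + y * v) ^+ 2 <= (norm2 x y * norm2 u v) ^+ 2.
  by rewrite exprMn !norm2_sq; have := sqr_ge0 (x * v - y * u); lra.
have h0 : 0 <= norm2 x y * norm2 u v by rewrite mulr_ge0 ?norm2_ge0.
by apply: (le_trans (ler_norm _)); rewrite -ler_sqr ?nnegrE ?normr_ge0 // real_normK ?num_real.
Qed.

Lemma norm2_tri x y u v : norm2 (x + u) (y + v) <= norm2 x y + norm2 u v.
Proof.
apply: norm2_le; first by rewrite addr_ge0 ?norm2_ge0.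
have h1 := norm2_sq x y; have h2 := norm2_sq u v.
by have := norm2_dot x y u v; lra.
Qed.

Lemma norm2_dist_tri x y x' y' x'' y'' :
  norm2 (x - x'') (y - y'') <= norm2 (x - x') (y - y') + norm2 (x' - x'') (y' - y'').
Proof.
have -> : x - x'' = (x - x') + (x' - x'') by ring.
have -> : y - y'' = (y - y') + (y' - y'') by ring.
exact: norm2_tri.
Qed.

Lemma norm2_sym x y u v : norm2 (x - u) (y - v) = norm2 (u - x) (v - y).
Proof. by rewrite -norm2N !opprB. Qed.

Lemma norm2_dir c s x y : c ^+ 2 + s ^+ 2 <= 1 -> c * x + s * y <= norm2 x y.
Proof.
move=> h; apply: (le_trans (norm2_dot _ _ _ _)).
rewrite -[leRHS]mul1r ler_wpM2r ?norm2_ge0 //; apply: norm2_le => //.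
by rewrite expr1n.
Qed.

Lemma norm2_gex x y : x <= norm2 x y.
Proof. by have := @norm2_dir 1 0 x y; rewrite mul1r mul0r addr0; apply; lra. Qed.

Lemma norm2_gey x y : y <= norm2 x y.
Proof. by have := @norm2_dir 0 1 x y; rewrite mul1r mul0r add0r; apply; lra. Qed.

Lemma norm2x0 x : 0 <= x -> norm2 x 0 = x.
Proof. by move=> x0; rewrite /norm2 expr0n addr0 sqrtr_sqr ger0_norm. Qed.

(** Projecting (x - u, y - v) on the direction of (x, y) loses at most [m]. *)
Lemma norm2_sub_dot x y u v m : 0 <= m -> x * u + y * v <= m * norm2 x y ->
  norm2 x y - m <= norm2 (x - u) (y - v).
Proof.
move=> m0 h; have [->|n0] := eqVneq (norm2 x y) 0.
  by have := norm2_ge0 (x - u) (y - v); lra.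
have np : 0 < norm2 x y by rewrite lt_neqAle eq_sym n0 norm2_ge0.
rewrite -(ler_pM2l np) mulrBr.
have := norm2_dot x y (x - u) (y - v); have := norm2_sq x y; nra.
Qed.

End Norm2.

(** * The wedge of angle 30 degrees *)

(* [r3] is sqrt 3, so that (x, y) |-> (x / 2 - (r3 / 2) * y, (r3 / 2) * x + y / 2) is
   the rotation by 60 degrees, and the wedge of angle 30 degrees on the positive
   x-axis is 0 <= y, r3 * y <= x. *)
Section Wedge.
Variables (R : rcfType) (r3 : R).
Hypotheses (r3_gt0 : 0 < r3) (r3_sq : r3 ^+ 2 = 3).
Implicit Types x y a b c t : R.

Local Notation n2 := (@norm2 R).

Lemma r3_bounds : 173 / 100 <= r3 <= 7 / 4.
Proof.
have h := r3_sq; have h0 := r3_gt0.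
apply/andP; split; rewrite leNgt; apply/negP => k.
  by have : 0 < (173 / 100 - r3) * (173 / 100 + r3); [apply: mulr_gt0|]; lra.
by have : 0 < (r3 - 7 / 4) * (7 / 4 + r3); [apply: mulr_gt0|]; lra.
Qed.

(* ((1 / 2) a, (r3 / 2) a) is the mirror image of (a, 0) in the side x = r3 * y. *)
Lemma reflect_foot a x y t :
  n2 (x - a / 2) (y - (r3 / 2) * a) <=
  n2 (r3 * t - a) t + n2 (x - r3 * t) (y - t).
Proof.
have -> : n2 (r3 * t - a) t = n2 (r3 * t - a / 2) (t - (r3 / 2) * a).
  apply: norm2_eq; by field: r3_sq.
by rewrite [leRHS]addrC; apply: norm2_dist_tri.
Qed.

Lemma rotated_foot_ge a b : 0 <= a -> a <= b -> a <= n2 (b - a / 2) (0 - (r3 / 2) * a).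
Proof. by move=> a0 ab; apply: norm2_ge; have := r3_sq; nra. Qed.

(** For [a = b] this is Pompeiu's inequality for the equilateral triangle formed by the apex, (a, 0)
    and its rotated image. Turning (x - a, y) by -120 degrees and adding the second vector gives (x,
    y) turned by -60 degrees; for [a < b] the squared norm only grows, by the quantity [Z] below. *)
Lemma wedge_between x y a b : 0 <= y -> r3 * y <= x -> 0 <= a -> a <= b ->
  n2 x y <= n2 (x - a) y + n2 (x - b / 2) (y - (r3 / 2) * b).
Proof.
move=> y0 yx a0 ab.
have -> : n2 (x - a) y = n2 ((r3 / 2) * y - (x - a) / 2) (- ((r3 / 2) * (x - a)) - y / 2).
  by apply: norm2_eq; field: r3_sq.
apply: le_trans (norm2_tri _ _ _ _); apply: norm2_mono.
have [r Er] : exists r, r = b - a by exists (b - a).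
have -> : b = a + r by rewrite Er; ring.
have r0 : 0 <= r by lra.
have h : 0 <= r * (x - r3 * y) by apply: mulr_ge0; lra.
rewrite -subr_ge0.
set Z := (Z in 0 <= Z).
have -> : Z = r ^+ 2 + r * (x - r3 * y) by rewrite /Z; field: r3_sq.
nra.
Qed.

Lemma wedge_to_foot x y a b : 0 <= y -> r3 * y <= x -> 0 <= a ->
  n2 x y - a / 2 <= n2 (x - a / 2) (y - (r3 / 2) * a) + n2 (x - b) y.
Proof.
move=> y0 yx a0; have r3b := r3_bounds; have r3s := r3_sq.
(* A low point is no farther from (a / 2, 0) than from the rotated foot. For a high one the weaker
   constant r3 / 2 is paid for by the second summand, which is at least [y]. *)
have [h|h] := lerP (2 * y) ((r3 / 2) * a).
  have h1 : n2 x y - a / 2 <= n2 (x - a / 2) (y - 0).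
    by apply: norm2_sub_dot; rewrite ?mulr0 ?addr0; have := norm2_gex x y; nra.
  have h2 : n2 (x - a / 2) (y - 0) <= n2 (x - a / 2) (y - (r3 / 2) * a).
    by apply: norm2_mono; nra.
  by have := norm2_ge0 (x - b) y; lra.
have h1 : n2 x y - (r3 / 2) * a <= n2 (x - a / 2) (y - (r3 / 2) * a).
  apply: norm2_sub_dot; first by nra.
  (* The direction of 60 degrees makes an angle of at least 30 degrees with (x, y). *)
  have : x * (1 / 2) + y * (r3 / 2) <= (r3 / 2) * n2 x y.
    have -> : (r3 / 2) * n2 x y = n2 ((r3 / 2) * x) ((r3 / 2) * y).
      have -> : (r3 / 2) * n2 x y = Num.sqrt ((r3 / 2) ^+ 2) * n2 x y.
        by rewrite sqrtr_sqr gtr0_norm //; lra.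
      by rewrite /norm2 -sqrtrM ?sqr_ge0 //; congr Num.sqrt; ring.
    apply: norm2_ge; apply: (@le_subE _ _ _ (x * (x - r3 * y) / 2)).
      by apply: divr_ge0 => //; apply: mulr_ge0; nra.
    by field: r3_sq.
  nra.
by have := norm2_gey (x - b) y; nra.
Qed.

Lemma detour_excess x y c c' : 0 <= y -> r3 * y <= x -> 0 <= c' -> c' <= c ->
  n2 (x - c) y + c' / 2 <= n2 (x - c / 2) (y - (r3 / 2) * c) + n2 (x - c') y.
Proof.
move=> y0 yx c0 cc; have r3b := r3_bounds; have r3s := r3_sq.
pose p := n2 (x - c) y; pose q := n2 (x - c / 2) (y - (r3 / 2) * c).
have psq : p ^+ 2 = (x - c) ^+ 2 + y ^+ 2 by apply: norm2_sq.
have qsq : q ^+ 2 = (x - c / 2) ^+ 2 + (y - (r3 / 2) * c) ^+ 2 by apply: norm2_sq.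
have p0 : 0 <= p := norm2_ge0 _ _.
have q0 : 0 <= q := norm2_ge0 _ _.
(* [m] is the component of (x, y) along the direction of -60 degrees; that of (c', 0) is c' / 2, so
   the two differ by at most the distance to (c', 0). If this distance is at least c' / 2, then
   [p <= q] is enough; otherwise 2 p + m <= 2 c, which gives [p + m <= q]. *)
pose m := x / 2 - (r3 / 2) * y.
have m0 : 0 <= m by rewrite /m; nra.
have qp : q ^+ 2 = p ^+ 2 + 2 * c * m.
  by rewrite qsq psq /m; field: r3_sq.
have [h|h] := lerP (c' / 2) (n2 (x - c') y).
  suff : p <= q by rewrite /p /q; lra.
  nra.
have hp : p <= (c - c') + n2 (x - c') y.
  have := norm2_tri (c' - c) 0 (x - c') y; rewrite add0r.
  have -> : c' - c + (x - c') = x - c by ring.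
  have -> : n2 (c' - c) 0 = c - c'.
    have -> : n2 (c' - c) 0 = n2 (c - c') 0 by apply: norm2_eq; ring.
    by rewrite norm2x0 //; lra.
  by rewrite /p; lra.
have hm : m - c' / 2 <= n2 (x - c') y.
  have := @norm2_dir _ (1 / 2) (- (r3 / 2)) (x - c') y; rewrite /m => h3.
  by apply: le_trans (h3 _); nra.
have hm' : c' / 2 - m <= n2 (x - c') y.
  have := @norm2_dir _ (- (1 / 2)) (r3 / 2) (x - c') y; rewrite /m => h3.
  by apply: le_trans (h3 _); nra.
suff : p + m <= q by rewrite /p /q; lra.
nra.
Qed.

End Wedge.

(** * Estimates for two wedges with turned axes *)

Section Turn.
Variables (R : rcfType) (r3 : R).
Hypotheses (r3_gt0 : 0 < r3) (r3_sq : r3 ^+ 2 = 3).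
Implicit Types x y a b c s t d z : R.
Local Notation n2 := (@norm2 R).

(** Here [c] and [s] are the cosine and sine of an angle of at most 30 degrees, and 1 - cos is |sin|
    times the tangent of half the angle. *)
Lemma small_turn c s : c ^+ 2 = 1 - s ^+ 2 -> r3 / 2 <= c ->
  0 <= 1 - c /\ 2 * (1 - c) <= `|s|.
Proof.
move=> cs hc; have /andP[r3l r3u] := r3_bounds r3_gt0 r3_sq.
have c1 : c <= 1 by rewrite leNgt; apply/negP => h; nra.
split; first by lra.
have n0 := normr_ge0 s; have n2 : `|s| ^+ 2 = s ^+ 2 by rewrite real_normK ?num_real.
have : `|s| <= 51 / 100 by rewrite leNgt; apply/negP => h; nra.
nra.
Qed.

(** The first vector on the right is X + R z - F, where R is the rotation by 60 degrees followed by
    (c, s), and F is (a, 0) rotated by 60 degrees. Replacing z by (b, 0) costs at most the last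
    summand. Since [s <= 0] turns the direction of 60 degrees towards X, the component of X along it
    does not decrease. *)
Lemma turn_neg x y (z1 z2 : R) a b c s :
  0 <= y -> r3 * y <= x -> 0 <= a -> a <= b ->
  c ^+ 2 = 1 - s ^+ 2 -> r3 / 2 <= c -> s <= 0 ->
  n2 x y <=
  n2 (x + (c * (z1 / 2 - r3 / 2 * z2) - s * (r3 / 2 * z1 + z2 / 2)) - a / 2)
     (y + (s * (z1 / 2 - r3 / 2 * z2) + c * (r3 / 2 * z1 + z2 / 2)) - r3 / 2 * a)
  + n2 (z1 - b) z2.
Proof.
move=> y0 yx a0 ab cs hc s0; have /andP[r3l r3u] := r3_bounds r3_gt0 r3_sq.
have ry : 0 <= r3 * y by apply: mulr_ge0; lra.
have [c1 hs] := small_turn cs hc; rewrite ler0_norm // in hs.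
rewrite -lerBlDr -addrA -[X in _ <= norm2 _ X]addrA.
set u := (c * _ - _ - _); set v := (s * _ + _ - _).
rewrite -(opprK u) -(opprK v); apply: norm2_sub_dot; first exact: norm2_ge0.
pose e1 := c / 2 - s * (r3 / 2); pose e2 := s / 2 + c * (r3 / 2).
have hd := norm2_dot x y (- ((z1 - b) * e1 - z2 * e2)) (- ((z1 - b) * e2 + z2 * e1)).
have en : n2 (- ((z1 - b) * e1 - z2 * e2)) (- ((z1 - b) * e2 + z2 * e1)) = n2 (z1 - b) z2.
  by apply: norm2_eq; rewrite /e1 /e2; field: r3_sq cs.
rewrite en in hd; rewrite [leRHS]mulrC; apply: le_trans hd.
(* [g] and [- h] are the components of (x, y) in the directions 60 and 150 degrees. *)
pose g := x / 2 + r3 / 2 * y; pose h := r3 / 2 * x - y / 2.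
have h0 : g <= r3 * h.
  by rewrite /g /h; apply: (@le_subE _ _ _ (x - r3 * y)); [lra|field: r3_sq].
have g0 : 0 <= g by rewrite /g; lra.
have hh0 : 0 <= h by rewrite -(pmulr_rge0 _ r3_gt0); lra.
have k : a * g <= b * (c * g - s * h).
  have g2 : g <= 2 * h by have : r3 * h <= 2 * h; [apply: ler_wpM2r|]; lra.
  have : (1 - c) * g <= (1 - c) * (2 * h) by apply: ler_wpM2l.
  have : 2 * (1 - c) * h <= - s * h by apply: ler_wpM2r.
  move=> k1 k2; have k3 : g <= c * g - s * h by lra.
  by apply: (le_trans (ler_wpM2l a0 k3)); apply: ler_wpM2r; lra.
suff : x * - u + y * - v - (x * (- ((z1 - b) * e1 - z2 * e2)) + y * (- ((z1 - b) * e2 + z2 * e1)))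
   = a * g - b * (c * g - s * h) by lra.
by rewrite /u /v /e1 /e2 /g /h; ring.
Qed.

(** Seen from the other frame, the multiple of [z1 - r3 * z2] reflects z in the side x = r3 * y; the
    rotated foot is here reflected in the x-axis. *)
Lemma turn_pos x y (z1 z2 : R) a b c s :
  0 <= y -> r3 * y <= x -> 0 <= a -> a <= b ->
  c ^+ 2 = 1 - s ^+ 2 -> r3 / 2 <= c -> 0 <= s -> n2 (z1 - b) z2 <= b / 2 ->
  n2 x y <=
  n2 (x + (z1 - r3 * z2) * (c / 2 + s * (r3 / 2)) - a / 2)
     (y + (z1 - r3 * z2) * (s / 2 - c * (r3 / 2)) + r3 / 2 * a)
  + n2 (z1 - b) z2.
Proof.
move=> y0 yx a0 ab cs hc s0 hm; have /andP[r3l r3u] := r3_bounds r3_gt0 r3_sq.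
have ry : 0 <= r3 * y by apply: mulr_ge0; lra.
have [c1 hs] := small_turn cs hc; rewrite ger0_norm // in hs.
rewrite -lerBlDr -addrA -[X in _ <= norm2 _ X]addrA.
set u := (_ - a / 2); set v := (_ + r3 / 2 * a).
rewrite -(opprK u) -(opprK v); apply: norm2_sub_dot; first exact: norm2_ge0.
set m := n2 (z1 - b) z2 in hm *; set N := n2 x y.
have m0 : 0 <= m := norm2_ge0 _ _.
pose t := (z1 - b) - r3 * z2.
have ht : - t <= 2 * m.
  have : (- (1 / 2)) * (z1 - b) + r3 / 2 * z2 <= m.
    apply: norm2_dir.
    by apply: (@le_subE _ _ _ 0) => //; field: r3_sq.
  by rewrite /t; lra.
(* Components of (x, y) along the directions -60 and 30 degrees, and along the direction -60 degrees
   turned by (c, s). *)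
pose g := x / 2 - r3 / 2 * y; pose h := r3 / 2 * x + y / 2; pose G := c * g + s * h.
have g0 : 0 <= g by rewrite /g; lra.
have hg : r3 * g <= h.
  by rewrite /g /h; apply: (@le_subE _ _ _ (2 * y)); [lra|field: r3_sq].
have gN : g <= N / 2 by have := norm2_gex x y; rewrite /g -/N; lra.
have gG : g <= G.
  have h0 : 0 <= h by apply: le_trans hg; apply: mulr_ge0 => //; lra.
  have g1 : g <= h by have : 1 * g <= r3 * g; [apply: ler_wpM2r|]; lra.
  have : (1 - c) * g <= (1 - c) * h by apply: ler_wpM2l.
  have : 2 * (1 - c) * h <= s * h by apply: ler_wpM2r.
  have : 0 <= (1 - c) * h by apply: mulr_ge0.
  by rewrite /G; lra.
have G0 : 0 <= G by lra.
have -> : x * - u + y * - v = a * g - (b + t) * G.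
  by rewrite /u /v /t /G /g /h; ring.
have tG : - t * G <= 2 * m * G by apply: ler_wpM2r; lra.
(* The loss [2 * m * G] is covered by [m * N] when [2 * G <= N]; beyond that the excess is capped by
   the hypothesis m <= b / 2. *)
have [hG|hG] := lerP (2 * G) N.
  have : a * g <= b * G by apply: ler_pM.
  have : m * (2 * G) <= m * N by apply: ler_wpM2l.
  lra.
have : m * (2 * G - N) <= b / 2 * (2 * G - N) by apply: ler_wpM2r; lra.
have : a * g <= b * (N / 2) by apply: ler_pM.
lra.
Qed.

(** A norm is convex and homogeneous, so it lies below the linear function that agrees with it on
    the two rays [y = 0] and [r3 * y = d - x]. *)
Lemma isosceles_far x y d : 0 <= y -> r3 * y <= d - x ->
  n2 (d - x) y <= d - x + (2 - r3) * y.
Proof.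
move=> y0 h; have /andP[r3l r3u] := r3_bounds r3_gt0 r3_sq.
apply: norm2_le; first by nra.
apply: (@le_subE _ _ _ (2 * (2 - r3) * y * (d - x - r3 * y))).
  by rewrite !mulr_ge0 //; lra.
by ring: r3_sq.
Qed.

End Turn.

(** * Distances to the apex of one wedge *)

Section Triple.
Variables (R : rcfType) (r3 : R) (I : Type).
Hypotheses (r3_gt0 : 0 < r3) (r3_sq : r3 ^+ 2 = 3).
Local Notation n2 := (@norm2 R).

(* [x i], [y i] are the coordinates of a vertex in the frame of the apex of the wedge,
   and [W i] is the time at which the path meets it. *)
Record wedge_triple (x y W : I -> R) (A B A' : I) : Prop := WedgeTriple {
  wt_dist : forall i j, W i <= W j -> n2 (x j - x i) (y j - y i) <= W j - W i;
  wt_ge0 : forall i, 0 <= y i;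
  wt_le : forall i, r3 * y i <= x i;
  wt_A : y A = 0;
  wt_A' : y A' = 0;
  wt_B : x B = r3 * y B;
  wt_leA : x A <= x A';
  wt_AB : W A < W B;
  wt_BA' : W B < W A' }.

Variables (x y W : I -> R) (A B A' : I).
Hypothesis T : wedge_triple x y W A B A'.

Lemma wt_dist' i j : W i <= W j -> n2 (x i - x j) (y i - y j) <= W j - W i.
Proof. by move=> h; rewrite norm2_sym; apply: (wt_dist T). Qed.

Lemma wt_x0 i : 0 <= x i.
Proof.
apply: le_trans (wt_le T i); apply: mulr_ge0; last exact: wt_ge0 T i.
exact: ltW.
Qed.

(** The leg from A to B is reflected in the second side, which contains B; the path then starts at
    the mirror image of A. *)
Lemma wt_legB X : W B <= W X ->
  n2 (x X - x A / 2) (y X - r3 / 2 * x A) <= W X - W A.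
Proof.
move=> hX; have hA := wt_dist T (ltW (wt_AB T)); have hB := wt_dist T hX.
have := reflect_foot r3_sq (x A) (x X) (y X) (y B).
by rewrite (wt_A T) subr0 (wt_B T) in hA; rewrite (wt_B T) in hB; lra.
Qed.

Lemma wt_legB' X : W X <= W B ->
  n2 (x X - x A' / 2) (y X - r3 / 2 * x A') <= W A' - W X.
Proof.
move=> hX; have hA := wt_dist' (ltW (wt_BA' T)); have hB := wt_dist' hX.
have := reflect_foot r3_sq (x A') (x X) (y X) (y B).
rewrite (wt_A' T) subr0 (wt_B T) in hA; rewrite [n2 (x X - x B) _]norm2_sym in hB.
by rewrite norm2_sym (wt_B T) in hB; lra.
Qed.

Lemma wt_AA'_legs : n2 (x A' - x A / 2) (0 - r3 / 2 * x A) <= W A' - W A.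
Proof. by have := wt_legB (ltW (wt_BA' T)); rewrite (wt_A' T). Qed.

(** x A / 2 is the distance from A to the second side. *)
Lemma wt_AB_half : x A / 2 <= W B - W A.
Proof.
apply: le_trans (wt_dist T (ltW (wt_AB T))); rewrite (wt_A T) subr0 (wt_B T).
apply: norm2_ge; apply: (@le_subE _ _ _ ((2 * y B - r3 / 2 * x A) ^+ 2)).
  exact: sqr_ge0.
by field: r3_sq.
Qed.

Lemma wt_P_B : n2 (x B) (y B) <= 2 * (W B - W A).
Proof.
have h : y B <= W B - W A.
  apply: le_trans (wt_dist T (ltW (wt_AB T))); rewrite (wt_A T) subr0.
  exact: norm2_gey.
apply: norm2_le; first by have := wt_ge0 T B; lra.
rewrite (wt_B T) exprMn r3_sq.
have h2 : y B ^+ 2 <= (W B - W A) ^+ 2 by rewrite ler_sqr ?nnegrE //; have := wt_ge0 T B; lra.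
lra.
Qed.

Lemma wt_AA' : x A' - x A / 2 <= W A' - W A.
Proof. exact: le_trans (norm2_gex _ _) wt_AA'_legs. Qed.

(** A vertex before A is reached through A, and the legs from A through B to A' are at least [x A]
    long. Between A and B, [wedge_between] applies to the feet A and A', with the leg from B to A'
    unfolded. *)
Lemma wt_before X L : (forall i j, W j - W i <= L) -> W X <= W B ->
  n2 (x X) (y X) <= L.
Proof.
move=> HL hX; have [h|h] := lerP (W X) (W A).
  have h1 := wt_dist' h; have h2 := wt_AA'_legs.
  have h3 := rotated_foot_ge r3_sq (wt_x0 A) (wt_leA T).
  have h4 := norm2_tri (x X - x A) (y X - y A) (x A) (y A).
  rewrite !subrK (wt_A T) norm2x0 ?wt_x0 // in h4 h1.
  by have := HL X A'; lra.
have h1 := wt_dist T (ltW h); have h2 := wt_legB' hX.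
have h3 := wedge_between r3_sq (wt_ge0 T X) (wt_le T X) (wt_x0 A) (wt_leA T).
rewrite (wt_A T) subr0 in h1.
by have := HL A A'; lra.
Qed.

(** Here and in [wt_middle] the distance may exceed the elapsed time by x A / 2, an amount to be
    recovered on the legs of the second wedge. *)
Lemma wt_after X : W A' <= W X -> n2 (x X) (y X) - x A / 2 <= W X - W A.
Proof.
move=> hX; have h1 := wt_dist T hX; have h2 := wt_AA'.
have h4 := norm2_tri (x X - x A') (y X - y A') (x A') (y A').
rewrite !subrK (wt_A' T) [n2 (x A') 0]norm2x0 ?wt_x0 // in h4 h1.
lra.
Qed.

Lemma wt_middle X : W B <= W X -> W X <= W A' ->
  n2 (x X) (y X) - x A / 2 <= W A' - W A.
Proof.
move=> h1 h2; have h3 := wt_legB h1; have h4 := wt_dist' h2.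
have := wedge_to_foot r3_gt0 r3_sq (x A') (wt_ge0 T X) (wt_le T X) (wt_x0 A).
by rewrite (wt_A' T) subr0 in h4; lra.
Qed.

(** Meant for the second wedge, where it concerns a vertex met between D and C'. *)
Lemma wt_detour X : W A <= W X -> W X <= W B ->
  n2 (x X - x A') (y X) + x A / 2 <= W A' - W A.
Proof.
move=> h1 h2; have h3 := wt_legB' h2; have h4 := wt_dist T h1.
have := detour_excess r3_gt0 r3_sq (wt_ge0 T X) (wt_le T X) (wt_x0 A) (wt_leA T).
by rewrite (wt_A T) subr0 in h4; lra.
Qed.

(** Meant for two wedges leaning on the same side, (d, 0) being the other apex. [isosceles_far]
    makes the target linear, except when X precedes A; each leg is then projected on a suitable
    direction. *)
Lemma wt_isosceles X M d lo : lo <= W A -> lo <= W X -> W B <= W M -> W X <= W M ->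
  x A <= d -> r3 * y X <= d - x X ->
  x M - d / 2 + n2 (d - x X) (y X) / 2 <= W M - lo.
Proof.
move=> l1 l2 hB hX dA hd; have /andP[r3l r3u] := r3_bounds r3_gt0 r3_sq.
have f := isosceles_far r3_gt0 r3_sq (wt_ge0 T X) hd.
have yX := wt_ge0 T X.
have xX := wt_le T X.
have [h|h] := lerP (W X) (W B); last first.
  (* X after B: the direction of -30 degrees used in [h4] is orthogonal to the rotated foot, so
     [x A] cancels. *)
  have h1 := wt_legB (ltW h); have h2 := wt_dist T hX.
  have h3 := norm2_gex (x M - x X) (y M - y X).
  have h4 : r3 / 2 * (x X - x A / 2) + (- (1 / 2)) * (y X - r3 / 2 * x A)
     <= n2 (x X - x A / 2) (y X - r3 / 2 * x A).
    by apply: norm2_dir; apply: (@le_subE _ _ _ 0) => //; field: r3_sq.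
  have h5 : 0 <= (r3 - 1) * (x X - r3 * y X) by apply: mulr_ge0; lra.
  have h6 : (r3 - 1) * (x X - r3 * y X) = r3 * x X - x X - 3 * y X + r3 * y X.
    by ring: r3_sq.
  lra.
have h2 := wt_dist T hB.
have h3 := norm2_gex (x M - x B) (y M - y B).
have [k|k] := lerP (W X) (W A).
  have h4 := wt_dist' k; have h5 := wt_legB hB.
  have h6 := norm2_gex (x M - x A / 2) (y M - r3 / 2 * x A).
  have h8 := wt_x0 A.
  have h7 : n2 (d - x X) (y X) <= n2 (x X - x A) (y X - y A) + (d - x A).
    have := norm2_tri (x A - x X) (y A - y X) (d - x A) 0.
    have -> : x A - x X + (d - x A) = d - x X by ring.
    have -> : n2 (d - x A) 0 = d - x A by rewrite norm2x0 //; lra.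
    rewrite (wt_A T) addr0 sub0r subr0.
    have -> : n2 (d - x X) (- y X) = n2 (d - x X) (y X) by apply: norm2_eq; ring.
    by have -> : n2 (x A - x X) (- y X) = n2 (x X - x A) (y X) by apply: norm2_eq; ring.
  have := norm2_ge0 (x X - x A) (y X - y A).
  lra.
have h4 := wt_dist T (ltW k); have h5 := wt_dist T h.
have h6 := norm2_gey (x X - x A) (y X - y A).
have yA := wt_A T.
(* X between A and B: along the direction of 60 degrees the component of B is exactly [x B], since B
   is on the second side. *)
have h7 : 1 / 2 * (x B - x X) + r3 / 2 * (y B - y X) <= n2 (x B - x X) (y B - y X).
  by apply: norm2_dir; apply: (@le_subE _ _ _ 0) => //; field: r3_sq.
rewrite (wt_B T) in h7 h3 h2 h5.
lra.
Qed.

End Triple.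

(** * Two wedges *)

Section TwoWedges.
Variables (R : rcfType) (r3 : R) (I : Type).
Hypotheses (r3_gt0 : 0 < r3) (r3_sq : r3 ^+ 2 = 3).
Local Notation n2 := (@norm2 R).

(* The two changes of frame between the wedges that are needed: the axes are opposite
   up to a rotation by at most 30 degrees, or the apexes lie on a common side line. *)
Definition turned (x1 y1 x2 y2 : I -> R) : Prop := exists q1 q2 c s : R,
  [/\ c ^+ 2 = 1 - s ^+ 2, r3 / 2 <= c &
   forall i, x1 i = q1 - (c * x2 i - s * y2 i) /\ y1 i = q2 - (s * x2 i + c * y2 i)].

Definition mirrored (x1 y1 x2 y2 : I -> R) : Prop := exists d : R,
   forall i, x1 i = d - x2 i /\ y1 i = y2 i.

(** The ways of interleaving A, B, A' with C, D, C' that non-alternation leaves, each with the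
    change of frame it needs. *)
Variant order_cases (x1 y1 x2 y2 W : I -> R) (A B A' C D C' : I) : Prop :=
| Disjoint of W A' <= W C
| Disjoint' of W C' <= W A
| Zigzag of W B <= W C & W A' <= W D & turned x1 y1 x2 y2
| SameSide of A = C & A' = C' & W B <= W D & mirrored x1 y1 x2 y2.

(** Reversing time exchanges the two wedges and inverts the change of frame; hence [x1 A <= x2 C']
    may be assumed. *)
Lemma order_cases_opp x1 y1 x2 y2 (W V : I -> R) A B A' C D C' :
  (forall i, V i = - W i) ->
  order_cases x1 y1 x2 y2 W A B A' C D C' ->
  order_cases x2 y2 x1 y1 V C' D C A' B A.
Proof.
move=> VW; case=> [h|h|h h' [q1 [q2 [c [s [cs hc e]]]]]|e e' h [d h']].
- by apply: Disjoint; rewrite !VW lerN2.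
- by apply: Disjoint'; rewrite !VW lerN2.
- apply: Zigzag; rewrite ?VW ?lerN2 //.
  exists (c * q1 + s * q2), (c * q2 - s * q1), c, (- s); split=> // [|i].
    by rewrite cs sqrrN.
  by have [-> ->] := e i; split; ring: cs.
- apply: SameSide; rewrite ?VW ?lerN2 //.
  by exists d => i; have [-> ->] := h' i; split=> //; ring.
Qed.

Section Cases.
Variables (x1 y1 x2 y2 W V : I -> R) (A B A' C D C' : I) (L : R).
Hypothesis VW : forall i, V i = - W i.
Hypothesis T1 : wedge_triple r3 x1 y1 W A B A'.
Hypothesis T2 : wedge_triple r3 x2 y2 V C' D C.
Hypothesis HL : forall i j, W j - W i <= L.
Hypothesis iso : forall i j, n2 (x1 j - x1 i) (y1 j - y1 i) = n2 (x2 j - x2 i) (y2 j - y2 i).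

(** The excess x1 A / 2 is at most x2 C' / 2, hence at most the length of the leg from D to C', as
    long as that leg is not already counted. *)
Lemma disjoint_fits X : x1 A <= x2 C' -> W B <= W X -> W A' <= W C \/ W C' <= W A ->
  n2 (x1 X) (y1 X) <= L.
Proof.
move=> ac hX.
have t1 := wt_AB_half r3_sq T2; have t2 := wt_AA' r3_sq T2; have t3 := wt_leA T2.
have o1 := wt_AB T2; have o2 := wt_BA' T2.
rewrite !VW in t1 t2 o1 o2.
case=> h; last first.
  have [k|k] := lerP (W A') (W X).
    by have := wt_after r3_gt0 r3_sq T1 k; have := HL C X; lra.
  by have := wt_middle r3_gt0 r3_sq T1 hX (ltW k); have := HL C A'; lra.
have [k|k] := lerP (W A') (W X); last first.
  by have := wt_middle r3_gt0 r3_sq T1 hX (ltW k); have := HL A C'; lra.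
have [k'|k'] := lerP (W X) (W D).
  by have := wt_after r3_gt0 r3_sq T1 k; have := HL A C'; lra.
(* Past D that leg serves to reach X; the distance is now bounded through C, and the half foot comes
   from the detour inside the second wedge. *)
have h1 := wt_after r3_gt0 r3_sq T1 h.
have h2 := norm2_tri (x1 X - x1 C) (y1 X - y1 C) (x1 C) (y1 C).
rewrite !subrK in h2.
have [k2|k2] := lerP (W X) (W C').
  have h3 : n2 (x1 X - x1 C) (y1 X - y1 C) = n2 (x2 X - x2 C) (y2 X).
    by rewrite iso (wt_A' T2) subr0.
  have := @wt_detour _ _ _ r3_gt0 r3_sq _ _ _ _ _ _ T2 X.
  rewrite !VW !lerN2 => /(_ k2 (ltW k')).
  by have := HL A C'; lra.
have h4 := wt_dist T1 (ltW k2).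
have h5 := norm2_dist_tri (x1 X) (y1 X) (x1 C') (y1 C') (x1 C) (y1 C).
have h6 : n2 (x1 C' - x1 C) (y1 C' - y1 C) = x2 C - x2 C'.
  by rewrite norm2_sym iso (wt_A' T2) (wt_A T2) subrr norm2x0 //; lra.
by have := HL A X; lra.
Qed.

Lemma zigzag_upto_C' X : x1 A <= x2 C' -> W B <= W C -> W A' <= W D ->
  turned x1 y1 x2 y2 -> W D <= W X -> W X <= W C' ->
  n2 (x1 X) (y1 X) <= W C' - W A.
Proof.
move=> ac hBC hAD [q1 [q2 [c [s [cs hc e]]]]] hX hX'.
have [ex ey] := e X; have [exD eyD] := e D; have [exC eyC] := e C.
have y20 := wt_A' T2; have y2C' := wt_A T2; have y2D := wt_B T2.
have h0 : n2 (x2 X - x2 C') (y2 X) <= W C' - W X.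
  by have := wt_dist' T1 hX'; rewrite iso y2C' subr0.
have a0 := wt_x0 r3_gt0 T1 A.
(* Two unfoldings: A in the second side of the first wedge on the way to C, and C in the second side
   of the second wedge on the way to X. *)
have [s0|s0] := lerP s 0.
  have h1 := turn_neg r3_gt0 r3_sq (x2 X) (y2 X) (wt_ge0 T1 X) (wt_le T1 X) a0 ac cs hc s0.
  have h2 := wt_legB r3_sq T1 hBC.
  have h3 : n2 (x2 X - x2 C / 2) (y2 X - r3 / 2 * x2 C) <= W X - W C.
    have := @wt_legB' _ _ _ r3_sq _ _ _ _ _ _ T2 X.
    by rewrite !VW lerN2 => /(_ hX); lra.
  set P := (P in n2 P _ + _) in h1; set Q := (Q in n2 _ Q + _) in h1.
  have h4 : n2 (x2 X - x2 C / 2) (y2 X - r3 / 2 * x2 C) =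
      n2 (P - (x1 C - x1 A / 2)) (Q - (y1 C - r3 / 2 * x1 A)).
    apply: norm2_eq; rewrite /P /Q ex ey exC eyC y20.
    by field: r3_sq cs.
  have := norm2_tri (P - (x1 C - x1 A / 2)) (Q - (y1 C - r3 / 2 * x1 A)) (x1 C - x1 A / 2) (y1 C - r3 / 2 * x1 A).
  by rewrite !subrK; lra.
have hAX : W A' <= W X by apply: le_trans hX.
(* Far from C', the leg from X to C' alone recovers the excess. *)
have [k|k] := lerP (n2 (x2 X - x2 C') (y2 X)) (x2 C' / 2); last first.
  by have := wt_after r3_gt0 r3_sq T1 hAX; lra.
(* Otherwise the path is followed from A to A', reflected in the first side, then to D, then to the
   mirror image of X in the second side of the second wedge. *)
have h1 := turn_pos r3_gt0 r3_sq (wt_ge0 T1 X) (wt_le T1 X) a0 ac cs hc (ltW s0) k.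
set P := (P in n2 P _ + _) in h1; set Q := (Q in n2 _ Q + _) in h1.
have h2 := wt_AA'_legs r3_sq T1; have h3 := wt_dist T1 hAD; have h4 := wt_dist T1 hX.
have h5 : n2 (x1 A' - x1 A / 2) (0 - r3 / 2 * x1 A) = n2 (x1 A' - x1 A / 2) (r3 / 2 * x1 A).
  by apply: norm2_eq; ring.
have h6 := norm2_tri (x1 D - x1 A') (y1 D - y1 A') (x1 A' - x1 A / 2) (r3 / 2 * x1 A).
have h7 : n2 (x1 X - x1 D) (y1 X - y1 D) =
  n2 (P - (x1 D - x1 A / 2)) (Q - (y1 D + r3 / 2 * x1 A)).
  apply: norm2_eq; rewrite /P /Q ex ey exD eyD y2D.
  by field: r3_sq cs.
have h8 := norm2_tri (P - (x1 D - x1 A / 2)) (Q - (y1 D + r3 / 2 * x1 A)) (x1 D - x1 A / 2) (y1 D + r3 / 2 * x1 A).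
rewrite !subrK in h8; rewrite (wt_A' T1) subr0 in h6.
have h9 : x1 D - x1 A' + (x1 A' - x1 A / 2) = x1 D - x1 A / 2 by ring.
by rewrite h9 in h6; rewrite (wt_A' T1) subr0 in h3; lra.
Qed.

Lemma zigzag_fits X : x1 A <= x2 C' -> W B <= W X -> W B <= W C -> W A' <= W D ->
  turned x1 y1 x2 y2 -> n2 (x1 X) (y1 X) <= L.
Proof.
move=> ac hX hBC hAD t.
have t1 := wt_AB_half r3_sq T2.
have o1 := wt_AB T2; have o2 := wt_BA' T2.
rewrite !VW in t1 o1 o2.
have [k|k] := lerP (W X) (W D).
  have [k'|k'] := lerP (W A') (W X).
    by have := wt_after r3_gt0 r3_sq T1 k'; have := HL A C'; lra.
  by have := wt_middle r3_gt0 r3_sq T1 hX (ltW k'); have := HL A C'; lra.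
have [k2|k2] := lerP (W X) (W C').
  by have := zigzag_upto_C' ac hBC hAD t (ltW k) k2; have := HL A C'; lra.
have h : n2 (x1 C') (y1 C') <= W C' - W A.
  by apply: zigzag_upto_C' => //; lra.
have h2 := norm2_tri (x1 X - x1 C') (y1 X - y1 C') (x1 C') (y1 C').
rewrite !subrK in h2.
by have := wt_dist T1 (ltW k2); have := HL A X; lra.
Qed.

Lemma same_side_sum X1 X2 : A = C -> A' = C' -> W B <= W D -> mirrored x1 y1 x2 y2 ->
  W B <= W X1 -> W X2 <= W D -> n2 (x1 X1) (y1 X1) + n2 (x2 X2) (y2 X2) <= 2 * L.
Proof.
move=> eA eA' hBD [d e] hX1 hX2.
have b1 := wt_P_B r3_sq T1; have b2 := wt_P_B r3_sq T2.
have o1 := wt_AB T2; rewrite !VW in b2 o1.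
have o1' := wt_AB T1.
(* If X1 precedes X2, they are reached from the apexes through B and D, and the pieces of path from
   B to X1 and from X2 to D are disjoint. *)
have [k|k] := lerP (W X2) (W X1); last first.
  have h1 := norm2_tri (x1 X1 - x1 B) (y1 X1 - y1 B) (x1 B) (y1 B).
  have h2 := norm2_tri (x2 X2 - x2 D) (y2 X2 - y2 D) (x2 D) (y2 D).
  rewrite !subrK in h1 h2; rewrite -iso in h2.
  by have := wt_dist T1 hX1; have := wt_dist' T1 hX2; have := HL A C'; lra.
(* [M] is the later of B and X2. The first wedge estimates the path before M and the second one the
   path after it; the abscissas of M add up to d and cancel the two terms - d / 2. *)
have [M [m1 m2 m3 m4]] : exists M, [/\ W B <= W M, W X2 <= W M, W M <= W D & W M <= W X1].
  have [m|m] := lerP (W B) (W X2); first by exists X2.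
  by exists B; split=> //; lra.
have d0 : x1 A <= d.
  by rewrite (e A).1; have := wt_x0 r3_gt0 T2 A; lra.
have d0' : x2 C' <= d.
  by have := (e C').1; have := wt_x0 r3_gt0 T1 C'; lra.
have w2 : r3 * y1 X2 <= d - x1 X2.
  by have := wt_le T2 X2; rewrite (e X2).1 (e X2).2; lra.
have w1 : r3 * y2 X1 <= d - x2 X1.
  by have := wt_le T1 X1; rewrite (e X1).1 (e X1).2; lra.
have := HL; set lo := Num.min (W A) (W X2); set hi := Num.max (W C') (W X1).
have hlo1 : lo <= W A by rewrite /lo ge_min lexx.
have hlo2 : lo <= W X2 by rewrite /lo ge_min lexx orbT.
have hhi1 : W C' <= hi by rewrite /hi le_max lexx.
have hhi2 : W X1 <= hi by rewrite /hi le_max lexx orbT.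
have f1 := wt_isosceles r3_gt0 r3_sq T1 hlo1 hlo2 m1 m2 d0 w2.
have f2 : x2 M - d / 2 + n2 (d - x2 X1) (y2 X1) / 2 <= V M - - hi.
  by apply: (wt_isosceles r3_gt0 r3_sq T2); rewrite ?VW ?lerN2.
rewrite VW in f2.
have e1 : n2 (d - x1 X2) (y1 X2) = n2 (x2 X2) (y2 X2).
  by rewrite (e X2).1 (e X2).2; congr norm2; ring.
have e2 : n2 (d - x2 X1) (y2 X1) = n2 (x1 X1) (y1 X1).
  by rewrite (e X1).1 (e X1).2; congr norm2; ring.
have eM := (e M).1.
move=> H; suff : hi - lo <= L by lra.
by rewrite /hi /lo maxEle minEle; case: ifP => _; case: ifP => _; apply: H.
Qed.

Lemma two_wedges_asym : x1 A <= x2 C' -> order_cases x1 y1 x2 y2 W A B A' C D C' ->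
  (forall X, n2 (x1 X) (y1 X) <= L) \/ (forall X, n2 (x2 X) (y2 X) <= L).
Proof.
move=> ac O.
have HV i j : V j - V i <= L by rewrite !VW; have := HL j i; lra.
case: O => [h|h|h h' t|eA eA' h m].
- left=> X; have [k|k] := lerP (W X) (W B); first exact: (wt_before r3_gt0 r3_sq T1 HL k).
  by apply: disjoint_fits => //; [exact: ltW|left].
- left=> X; have [k|k] := lerP (W X) (W B); first exact: (wt_before r3_gt0 r3_sq T1 HL k).
  by apply: disjoint_fits => //; [exact: ltW|right].
- left=> X; have [k|k] := lerP (W X) (W B); first exact: (wt_before r3_gt0 r3_sq T1 HL k).
  by apply: zigzag_fits => //; exact: ltW.
have [H|/existsNP[X1 /negP]] := pselect (forall X, n2 (x1 X) (y1 X) <= L); first by left.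
rewrite -ltNge => l1; right=> X2; rewrite leNgt; apply/negP => l2.
have k1 : W B <= W X1.
  rewrite leNgt; apply/negP => k.
  by have := wt_before r3_gt0 r3_sq T1 HL (ltW k); lra.
have k2 : W X2 <= W D.
  rewrite leNgt; apply/negP => k.
  have := @wt_before _ _ _ r3_gt0 r3_sq _ _ _ _ _ _ T2 X2 _ HV.
  by rewrite !VW lerN2 => /(_ (ltW k)); lra.
by have := same_side_sum eA eA' h m k1 k2; lra.
Qed.

End Cases.

Lemma two_wedges x1 y1 x2 y2 (W V : I -> R) A B A' C D C' L :
  (forall i, V i = - W i) ->
  wedge_triple r3 x1 y1 W A B A' -> wedge_triple r3 x2 y2 V C' D C ->
  (forall i j, W j - W i <= L) ->
  (forall i j, n2 (x1 j - x1 i) (y1 j - y1 i) = n2 (x2 j - x2 i) (y2 j - y2 i)) ->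
  order_cases x1 y1 x2 y2 W A B A' C D C' ->
  (forall X, n2 (x1 X) (y1 X) <= L) \/ (forall X, n2 (x2 X) (y2 X) <= L).
Proof.
move=> VW T1 T2 HL iso O; have [h|h] := lerP (x1 A) (x2 C').
  exact: two_wedges_asym VW T1 T2 HL iso h O.
apply/or_comm; apply: (two_wedges_asym _ T2 T1 _ _ (ltW h) (order_cases_opp VW O)) => //.
- by move=> i; rewrite VW opprK.
- by move=> i j; rewrite !VW; have := HL j i; lra.
Qed.

End TwoWedges.

(** * Contacts around the hull *)

Lemma small_lt (R : realFieldType) (l : seq R) : all (fun e => 0 < e) l ->
  exists2 s : R, 0 < s & all (fun e => s < e) l.
Proof.
elim: l => [_|e l IH] /=; first by exists 1.
move=> /andP[e0 /IH[s s0 hs]]; exists (Num.min s e / 2).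
  by rewrite divr_gt0 // lt_min s0.
have h : Num.min s e / 2 < Num.min s e by have : 0 < Num.min s e; [rewrite lt_min s0|lra].
apply/andP; split; first by apply: (lt_le_trans h); rewrite ge_min lexx orbT.
apply: sub_all hs => x /= hx; apply: lt_trans hx; apply: (lt_le_trans h).
by rewrite ge_min lexx.
Qed.

Section Contacts.
Variables (R : realFieldType) (pi : R) (I : Type).
Implicit Types (supp : R -> I -> Prop) (W : I -> R).

(* [supp t i]: the vertex [i] is extreme in direction [t].  [side_supp] selects, by
   the sign of [k], an end of the contact set of direction [t]. *)
Definition side_supp supp (k t : R) (i : I) : Prop :=
  exists2 e : R, 0 < e & forall s, 0 < s < e -> supp (t + k * s) i.

Definition turn_periodic supp : Prop := forall t i, supp t i <-> supp (t + 2 * pi) i.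

Definition no_alternation supp W : Prop :=
  forall t1 t2 t3 t4 w x y z, t1 < t2 -> t2 < t3 -> t3 < t4 -> t4 < t1 + 2 * pi ->
  supp t1 w -> supp t2 x -> supp t3 y -> supp t4 z ->
  W w < W x -> W w < W z -> W y < W x -> W y < W z -> False.

Definition sharp supp : Prop :=
  forall t1 t2 i j, t1 < t2 -> t2 < t1 + pi ->
  supp t1 i -> supp t1 j -> supp t2 i -> supp t2 j -> i = j.

(* [mu - k * (pi / 2)] and [mu + k * (2 * pi / 3)] are the outer normals of the two
   sides of the wedge; [k] = 1 or -1 is its orientation. *)
Record near_triple supp W (k mu : R) (A B A' : I) : Prop := NearTriple {
  nt_A : side_supp supp (- k) (mu - k * (pi / 2)) A;
  nt_A' : side_supp supp k (mu - k * (pi / 2)) A';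
  nt_B : side_supp supp (- k) (mu + k * (2 * pi / 3)) B;
  nt_AB : W A < W B;
  nt_BA' : W B < W A' }.

(* Discarding the irrelevant hypotheses keeps [lra] fast. *)
Local Ltac contact_lra :=
  repeat match goal with H : forall _, _ |- _ => clear H end;
  repeat match goal with H : near_triple _ _ _ _ _ _ _ |- _ => clear H end;
  repeat match goal with H : is_true (0 < ?e), K : is_true (_ < ?e) |- _ => clear H end;
  lra.

Section Order.
Variables (supp : R -> I -> Prop) (W V : I -> R) (A B A' C D C' : I).
Hypothesis p0 : 0 < pi.
Hypothesis per : turn_periodic supp.
Hypothesis NA : no_alternation supp W.
Hypothesis shp : sharp supp.
Hypothesis VW : forall i, V i = - W i.

Lemma supp_pos t t' i : t' = t + 2 * pi -> supp t i -> supp t' i.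
Proof. by move=> ->; rewrite -per. Qed.

Lemma supp_eq t t' i : t' = t -> supp t i -> supp t' i.
Proof. by move=> ->. Qed.

(** Both vertices are extreme in two distinct directions close to [t], so sharpness identifies
    them. *)
Lemma side_unique k t i j : k = 1 \/ k = -1 ->
  side_supp supp k t i -> side_supp supp k t j -> i = j.
Proof.
move=> hk [e e0 h] [e' e'0 h'].
have [s s0 /and4P[s1 s2 s3 _]] := @small_lt R [:: e; e'; pi] ltac:(by rewrite /= e0 e'0 p0).
have f u : 0 < u <= s -> supp (t + k * u) i /\ supp (t + k * u) j.
  by move=> /andP[u0 us]; split; [apply: h|apply: h']; apply/andP; split => //; lra.
have [a1 a2] := f s ltac:(by rewrite s0 lexx).
have [b1 b2] := f (s / 2) ltac:(by apply/andP; split; lra).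
by case: hk a1 a2 b1 b2 => -> a1 a2 b1 b2;
   [apply: (shp _ _ b1 b2 a1 a2)|apply: (shp _ _ a1 a2 b1 b2)]; lra.
Qed.

(** For each range of the turn [p] between the wedges, the cyclic order of the six contacts is
    known, and four of them alternate unless the stated order holds. *)
Lemma order_same mu1 mu2 : mu1 <= mu2 < mu1 + 2 * pi ->
  near_triple supp W 1 mu1 A B A' -> near_triple supp V 1 mu2 C' D C ->
  [\/ W A' <= W C, W C' <= W A |
     [/\ W B <= W C, W A' <= W D & 5 * pi / 6 <= mu2 - mu1 <= 7 * pi / 6]].
Proof.
move=> /andP[m1 m2] N1 N2.
have [h1|h1] := lerP (W A') (W C); first by constructor 1.
have [h2|h2] := lerP (W C') (W A); first by constructor 2.
constructor 3.
have o1 := nt_AB N1; have o2 := nt_BA' N1.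
have := nt_AB N2; have := nt_BA' N2; rewrite !VW !ltrN2 => o3 o4.
have [eA eA0 sA] := nt_A N1; have [eA' eA'0 sA'] := nt_A' N1; have [eB eB0 sB] := nt_B N1.
have [eC' eC'0 sC'] := nt_A N2; have [eC eC0 sC] := nt_A' N2; have [eD eD0 sD] := nt_B N2.
pose b := mu1 + 2 * pi / 3.
have [p Ep] : exists p, p = mu2 - mu1 by eexists.
have Em : mu2 = mu1 + p by rewrite Ep; ring.
(* One small [s] serves all six contacts: A, B, C' and D are extreme just before the normal of their
   side, A' and C just after it. Full turns are added so that all directions increase from [b]. *)
have pick (g : R) : 0 < g -> exists s, [/\ 0 < s, s < g & [/\
  supp (b + 5 * pi / 6 - s) A, supp (b + 5 * pi / 6 + s) A' & supp (b - s) B] /\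
  [/\ supp (b + p + 5 * pi / 6 - s) C', supp (b + p + 5 * pi / 6 + s) C &
     supp (b + p - s) D]].
  move=> g0.
  have := @small_lt R [:: g; eA; eA'; eB; eC'; eC; eD].
  rewrite /= g0 eA0 eA'0 eB0 eC'0 eC0 eD0 => /(_ isT)[s s0].
  move=> /and5P[sg s1 s2 s3 /and4P[s4 s5 s6 _]].
  exists s; split=> //; split; split.
  - by apply: (supp_pos _ (sA s _)); [rewrite /b; field|rewrite s0].
  - by apply: (supp_pos _ (sA' s _)); [rewrite /b; field|rewrite s0].
  - by apply: (supp_eq _ (sB s _)); [rewrite /b; field|rewrite s0].
  - by apply: (supp_pos _ (sC' s _)); [rewrite /b Em; field|rewrite s0].
  - by apply: (supp_pos _ (sC s _)); [rewrite /b Em; field|rewrite s0].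
  - by apply: (supp_eq _ (sD s _)); [rewrite /b Em; field|rewrite s0].
have up t i : supp t i -> supp (t + 2 * pi) i by move=> h; apply: (supp_pos _ h).
(* Small turns are impossible. The values 0 and 5 * pi / 6 are separate because contacts then
   coincide, A with C' and D with A. *)
have [p1|p1] := lerP p (5 * pi / 6).
  exfalso; have [pz|pz] := eqVneq p 0.
    have e : A = C'.
      apply: (@side_unique (-1) (b + 5 * pi / 6)); first by right.
        exists eA => // s hs; apply: (supp_pos _ (sA s hs)); rewrite /b; by field.
      exists eC' => // s hs; apply: (supp_pos _ (sC' s hs)); rewrite /b Em pz; by field.
    by rewrite e in h2; lra.
  have pp : 0 < p by rewrite lt_neqAle eq_sym pz; lra.
  have [pe|pe] := eqVneq p (5 * pi / 6).
    have e : D = A.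
      apply: (@side_unique (-1) (b + 5 * pi / 6)); first by right.
        exists eD => // s hs; apply: (supp_eq _ (sD s hs)); rewrite /b Em pe; by field.
      exists eA => // s hs; apply: (supp_pos _ (sA s hs)); rewrite /b; by field.
    rewrite -e in o1 *.
    have [s [s0 s1 [[a a' bb] [c' c d]]]] := pick (pi / 12) ltac:(lra).
    rewrite pe in c.
    by apply: (NA _ _ _ _ a a' c (up _ _ bb)); rewrite -?e; contact_lra.
  have pl : p < 5 * pi / 6 by rewrite lt_neqAle pe.
  have [s [s0 s1 [[a a' bb] [c' c d]]]] := pick (Num.min p (5 * pi / 6 - p) / 4)
    ltac:(by rewrite divr_gt0 // lt_min pp subr_gt0).
  rewrite ltr_pdivlMr // lt_min in s1; have /andP[s2 s3] := s1.
  have dA : W D <= W A.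
    rewrite leNgt; apply/negP => dA.
    by apply: (NA _ _ _ _ a c' c (up _ _ d)); contact_lra.
  by apply: (NA _ _ _ _ d a' c (up _ _ bb)); contact_lra.
have [p2|p2] := ltrP p (7 * pi / 6).
  have [s [s0 s1 [[a a' bb] [c' c d]]]] := pick (Num.min (p - 5 * pi / 6) (7 * pi / 6 - p) / 4)
    ltac:(by rewrite divr_gt0 // lt_min !subr_gt0 p1).
  rewrite ltr_pdivlMr // lt_min in s1; have /andP[s2 s3] := s1.
  split; last by apply/andP; split; rewrite -Ep; lra.
    rewrite leNgt; apply/negP => k.
    by apply: (NA _ _ _ _ c (up _ _ bb) (up _ _ a) (up _ _ c')); contact_lra.
  rewrite leNgt; apply/negP => k.
  by apply: (NA _ _ _ _ a a' d c'); contact_lra.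
exfalso.
have p3 : p < 2 * pi by rewrite Ep; lra.
have [s [s0 s1 [[a a' bb] [c' c d]]]] := pick (Num.min (pi / 12) (2 * pi - p) / 4)
    ltac:(by rewrite divr_gt0 // lt_min subr_gt0 p3 divr_gt0).
rewrite ltr_pdivlMr // lt_min in s1; have /andP[s2 s3] := s1.
have aD : W A' <= W D.
  rewrite leNgt; apply/negP => k.
  by apply: (NA _ _ _ _ a a' d c'); contact_lra.
(* At this value C' and B have the same outer normal and coincide. *)
have [pe|pe] := eqVneq p (7 * pi / 6).
  have e : C' = B.
    apply: (@side_unique (-1) (b + 2 * pi)); first by right.
      exists eC' => // u hu; apply: (supp_pos _ (sC' u hu)); rewrite /b Em pe; by field.
    exists eB => // u hu; apply: (supp_pos _ (sB u hu)); rewrite /b; by field.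
  by rewrite e in o4; lra.
have pl : 7 * pi / 6 < p by rewrite lt_neqAle eq_sym pe.
clear s s0 s1 s2 s3 a a' bb c' c d.
have [s [s0 s1 [[a a' bb] [c' c d]]]] := pick (Num.min (pi / 12) (p - 7 * pi / 6) / 4)
    ltac:(by rewrite divr_gt0 // lt_min subr_gt0 pl divr_gt0).
rewrite ltr_pdivlMr // lt_min in s1; have {s1} /andP[s1 s2'] := s1.
by apply: (NA _ _ _ _ (up _ _ bb) c' c (up _ _ a')); contact_lra.
Qed.

(** Unless the first sides lie on one line, A, A', C, C' come in this cyclic order and alternate. *)
Lemma order_opp mu1 mu2 : mu1 + pi <= mu2 < mu1 + 3 * pi ->
  near_triple supp W 1 mu1 A B A' -> near_triple supp V (-1) mu2 C' D C ->
  [\/ W A' <= W C, W C' <= W A |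
     [/\ A = C, A' = C', W B <= W D & mu2 = mu1 + pi]].
Proof.
move=> /andP[m1 m2] N1 N2.
have [h1|h1] := lerP (W A') (W C); first by constructor 1.
have [h2|h2] := lerP (W C') (W A); first by constructor 2.
constructor 3.
have o1 := nt_AB N1; have o2 := nt_BA' N1.
have := nt_AB N2; have := nt_BA' N2; rewrite !VW !ltrN2 => o3 o4.
have [eA eA0 sA] := nt_A N1; have [eA' eA'0 sA'] := nt_A' N1; have [eB eB0 sB] := nt_B N1.
have [eC' eC'0 sC'] := nt_A N2; have [eC eC0 sC] := nt_A' N2; have [eD eD0 sD] := nt_B N2.
have [pe|pe] := eqVneq mu2 (mu1 + pi); last first.
  exfalso; have pp : mu1 + pi < mu2 by rewrite lt_neqAle eq_sym pe.
  have := @small_lt R [:: mu2 - mu1 - pi; mu1 + 3 * pi - mu2; eA * 2; eA' * 2; eC' * 2; eC * 2].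
  rewrite /= !subr_gt0 !mulr_gt0 // m2 => -[|s s0]; first by rewrite !andbT; lra.
  move=> /and5P[s1 s2 s3 s4 /and3P[s5 s6 _]].
  have hA := supp_pos erefl (sA (s / 2) ltac:(by apply/andP; split; lra)).
  have hA' := supp_pos erefl (sA' (s / 2) ltac:(by apply/andP; split; lra)).
  have hC := sC (s / 2) ltac:(by apply/andP; split; lra).
  have hC' := sC' (s / 2) ltac:(by apply/andP; split; lra).
  by apply: (NA _ _ _ _ hA hA' hC hC'); contact_lra.
have e : A = C.
  apply: (@side_unique (-1) (mu1 + 3 * pi / 2)); first by right.
    exists eA => // s hs; apply: (supp_pos _ (sA s hs)); by field.
  exists eC => // s hs; apply: (supp_eq _ (sC s hs)); rewrite pe; by field.
have e' : A' = C'.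
  apply: (@side_unique 1 (mu1 + 3 * pi / 2)); first by left.
    exists eA' => // s hs; apply: (supp_pos _ (sA' s hs)); by field.
  exists eC' => // s hs; apply: (supp_eq _ (sC' s hs)); rewrite pe; by field.
split=> //; rewrite leNgt; apply/negP => k.
have := @small_lt R [:: pi / 12; eA; eA'; eB; eD].
rewrite /= !divr_gt0 // eA0 eA'0 eB0 eD0 => /(_ isT)[s s0].
move=> /and5P[s1 s2 s3 s4 /andP[s5 _]].
have hA := supp_pos erefl (sA s ltac:(by rewrite s0)).
have hA' := supp_pos erefl (sA' s ltac:(by rewrite s0)).
have hB := supp_pos erefl (sB s ltac:(by rewrite s0)).
have hD := supp_pos erefl (sD s ltac:(by rewrite s0)).
by apply: (NA _ _ _ _ hA hA' hD hB); rewrite ?pe; contact_lra.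
Qed.

End Order.
End Contacts.

(** * Directions modulo full turns *)

Section Turns.
Variables (R : archiRealFieldType) (pi : R) (I : Type).
Hypothesis p0 : 0 < pi.
Implicit Types (supp : R -> I -> Prop) (W V : I -> R).

Lemma turn_into (x lo : R) : exists m : int, lo <= x + 2 * pi * m%:~R < lo + 2 * pi.
Proof.
have p2 : 0 < 2 * pi by rewrite mulr_gt0.
pose y := (x - lo) / (2 * pi); exists (- Num.floor y).
have e : x = lo + 2 * pi * y by rewrite /y; field; lra.
have := floor_itv y; rewrite intrD => /andP[h1 h2].
rewrite mulrNz {1 2}e; set f := (Num.floor y)%:~R in h1 h2 *.
have h3 : 2 * pi * f <= 2 * pi * y by rewrite ler_pM2l.
have h4 : 2 * pi * y < 2 * pi * (f + 1) by rewrite ltr_pM2l.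
by apply/andP; split; lra.
Qed.

Lemma supp_turns supp t i (m : int) : turn_periodic pi supp ->
  supp t i -> supp (t + 2 * pi * m%:~R) i.
Proof.
move=> per; elim: m t => [t|n IH t|n IH t]; first by rewrite mulr0 addr0.
  move=> /IH/per; congr supp; rewrite intS intrD; ring.
move=> /IH h; apply/per; move: h; congr supp.
by rewrite intS opprD intrD mulrNz; ring.
Qed.

Lemma near_triple_turns supp W k mu A B A' (m : int) : turn_periodic pi supp ->
  near_triple pi supp W k mu A B A' -> near_triple pi supp W k (mu + 2 * pi * m%:~R) A B A'.
Proof.
move=> per [[a a0 ha] [a' a'0 ha'] [b b0 hb] h1 h2]; split=> //.
- exists a => // s /ha/(supp_turns m per); congr supp; ring.
- exists a' => // s /ha'/(supp_turns m per); congr supp; ring.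
- exists b => // s /hb/(supp_turns m per); congr supp; ring.
Qed.

(** A reflection of the plane exchanges the two orientations. *)
Lemma near_triple_flip supp W k mu A B A' :
  near_triple pi supp W k mu A B A' ->
  near_triple pi (fun t => supp (- t)) W (- k) (- mu) A B A'.
Proof.
move=> [[a a0 ha] [a' a'0 ha'] [b b0 hb] h1 h2]; split=> //.
- exists a => // s /ha; congr supp; ring.
- exists a' => // s /ha'; congr supp; ring.
- exists b => // s /hb; congr supp; ring.
Qed.

Variant order_outcome W A B A' C D C' (k1 k2 mu1 mu2 : R) : Prop :=
| OutDisjoint of W A' <= W C
| OutDisjoint' of W C' <= W A
| OutZigzag (m : int) of k1 = k2 & W B <= W C & W A' <= W D &
   5 * pi / 6 <= mu2 - mu1 + 2 * pi * m%:~R <= 7 * pi / 6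
| OutSameSide (m : int) of k1 = - k2 & A = C & A' = C' & W B <= W D &
   mu2 - mu1 + 2 * pi * m%:~R = pi.

Lemma order_facts1 supp W V A B A' C D C' k2 mu1 mu2 :
  turn_periodic pi supp -> no_alternation pi supp W -> sharp pi supp ->
  (forall i, V i = - W i) -> k2 = 1 \/ k2 = -1 ->
  near_triple pi supp W 1 mu1 A B A' -> near_triple pi supp V k2 mu2 C' D C ->
  order_outcome W A B A' C D C' 1 k2 mu1 mu2.
Proof.
move=> per NA shp VW [->|->] N1 N2.
  have [m hm] := turn_into mu2 mu1.
  have [h|h|[h1 h2 h3]] := order_same p0 per NA shp VW hm N1 (near_triple_turns m per N2).
  - exact: OutDisjoint.
  - exact: OutDisjoint'.
  by apply: (@OutZigzag _ _ _ _ _ _ _ _ _ _ _ (m)) => //; move: h3; rewrite addrAC.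
have [m hm] := turn_into mu2 (mu1 + pi).
have hm' : mu1 + pi <= mu2 + 2 * pi * m%:~R < mu1 + 3 * pi.
  by move: hm => /andP[-> hm] /=; lra.
have [h|h|[h1 h2 h3 h4]] := order_opp p0 per NA shp VW hm' N1 (near_triple_turns m per N2).
- exact: OutDisjoint.
- exact: OutDisjoint'.
by apply: (@OutSameSide _ _ _ _ _ _ _ _ _ _ _ (m)) => //; [rewrite opprK|rewrite addrAC h4; ring].
Qed.

Lemma order_facts supp W V A B A' C D C' k1 k2 mu1 mu2 :
  turn_periodic pi supp -> no_alternation pi supp W -> no_alternation pi supp V ->
  sharp pi supp ->
  (forall i, V i = - W i) -> k1 = 1 \/ k1 = -1 -> k2 = 1 \/ k2 = -1 ->
  near_triple pi supp W k1 mu1 A B A' -> near_triple pi supp V k2 mu2 C' D C ->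
  order_outcome W A B A' C D C' k1 k2 mu1 mu2.
Proof.
move=> per NA NAV shp VW [->|->] hk2 N1 N2; first exact: order_facts1 N1 N2.
pose supp' t := supp (- t).
have per' : turn_periodic pi supp'.
  move=> t i; rewrite /supp' (per (- (t + 2 * pi)) i).
  by have -> : - (t + 2 * pi) + 2 * pi = - t by ring.
have NA' : no_alternation pi supp' W.
  move=> t1 t2 t3 t4 w x y z h1 h2 h3 h4 s1 s2 s3 s4 k1' k2' k3 k4.
  apply: (NAV (- t4) (- t3) (- t2) (- t1) z y x w); rewrite ?VW ?ltrN2 //.
  lra.
have shp' : sharp pi supp'.
  move=> t1 t2 i j h1 h2 a b c d.
  by apply: (shp (- t2) (- t1) i j) => //; lra.
have N1' := near_triple_flip N1; have N2' := near_triple_flip N2.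
rewrite opprK in N1'.
have hk2' : - k2 = 1 \/ - k2 = -1 by case: hk2 => ->; rewrite ?opprK; [right|left].
case: (order_facts1 per' NA' shp' VW hk2' N1' N2') => [h|h|m h1 h2 h3 h4|m h1 h2 h3 h4 h5].
- exact: OutDisjoint.
- exact: OutDisjoint'.
(* The flip negates mu2 - mu1; one more turn brings the interval centred at pi back to itself. *)
- apply: (@OutZigzag _ _ _ _ _ _ _ _ _ _ _ (- m + 1)) => //; first by rewrite h1 opprK.
  rewrite intrD mulrNz; move: h4 => /andP[h4 h5]; apply/andP; split; lra.
apply: (@OutSameSide _ _ _ _ _ _ _ _ _ _ _ (- m + 1)) => //; first by rewrite -(opprK k2) -h1.
rewrite intrD mulrNz; lra.
Qed.

End Turns.

(** * Support directions of a finite point set *)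

Section Supports.
Variables (R : realType) (I : finType) (p : I -> R * R).
Local Notation pi := (@pi R).

Definition dot_dir (t : R) (v : R * R) : R := v.1 * cos t + v.2 * sin t.

Definition supports (t : R) (i : I) : Prop :=
  forall j, dot_dir t (p j) <= dot_dir t (p i).

Lemma dot_dirD t s v :
  dot_dir (t + s) v = cos s * dot_dir t v + sin s * dot_dir (t + pi / 2) v.
Proof. by rewrite /dot_dir cosDpihalf sinDpihalf cosD sinD; ring. Qed.

Lemma dot_dir_turn t v : dot_dir (t + 2 * pi) v = dot_dir t v.
Proof.
have -> : 2 * pi = pi *+ 2 by rewrite mulr_natl.
by congr (_ * _ + _ * _); [exact: cosD2pi|exact: sinD2pi].
Qed.

Lemma supports_periodic : turn_periodic pi supports.
Proof. by move=> t i; rewrite /supports; split=> h j; have := h j; rewrite !dot_dir_turn. Qed.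

(* Over an arc shorter than a half turn the middle direction is a nonnegative
   combination of the two outer ones. *)
Lemma dot_dir_between a b c v :
  sin (c - a) * dot_dir b v = sin (c - b) * dot_dir a v + sin (b - a) * dot_dir c v.
Proof.
rewrite /dot_dir !sinB.
have h := cos2Dsin2 b; have h1 := cos2Dsin2 a; have h2 := cos2Dsin2 c.
ring.
Qed.

Lemma dot_dir_inj t v w : dot_dir t v = dot_dir t w ->
  dot_dir (t + pi / 2) v = dot_dir (t + pi / 2) w -> v = w.
Proof.
rewrite /dot_dir cosDpihalf sinDpihalf => h1 h2.
have h := cos2Dsin2 t.
have e1 : v.1 = w.1.
  have -> : v.1 = (v.1 * cos t + v.2 * sin t) * cos t - (v.1 * - sin t + v.2 * cos t) * sin t.
    by rewrite -[LHS]mulr1 -h; ring.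
  rewrite h1 h2 -[RHS]mulr1 -h; ring.
have e2 : v.2 = w.2.
  have -> : v.2 = (v.1 * cos t + v.2 * sin t) * sin t + (v.1 * - sin t + v.2 * cos t) * cos t.
    by rewrite -[LHS]mulr1 -h; ring.
  rewrite h1 h2 -[RHS]mulr1 -h; ring.
by case: v w e1 e2 {h1 h2} => [v1 v2] [w1 w2] /= -> ->.
Qed.

Hypothesis p_inj : injective p.

Lemma supports_sharp : sharp pi supports.
Proof.
move=> t1 t2 i j h1 h2 a b c d.
have e1 : dot_dir t1 (p i) = dot_dir t1 (p j) by apply/eqP; rewrite eq_le a b.
have e2 : dot_dir t2 (p i) = dot_dir t2 (p j) by apply/eqP; rewrite eq_le c d.
apply/p_inj/(dot_dir_inj e1).
have s0 : 0 < sin (t2 - t1) by apply: sin_gt0_pi; apply/andP; split; lra.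
move: e2; have D v := dot_dirD t1 (t2 - t1) v.
rewrite addrC subrK in D.
rewrite !D e1 => /addrI/mulfI; apply.
by rewrite gt_eqF.
Qed.

Hypothesis i0 : I.

Lemma small_all (P : I -> R -> Prop) :
  (forall j, exists2 e : R, 0 < e & forall s, 0 < s < e -> P j s) ->
  exists2 e : R, 0 < e & forall s, 0 < s < e -> forall j, P j s.
Proof.
move=> h; have [f hf] : {f : I -> R & forall j, 0 < f j /\ forall s, 0 < s < f j -> P j s}.
  apply: (@choice _ _ (fun j e => 0 < e /\ forall s, 0 < s < e -> P j s)) => j.
  by have [e e0 he] := h j; exists e.
have := @small_lt R [seq f j | j <- enum I].
case=> [|e e0 /allP he]; first by apply/allP => _ /mapP[j _ ->]; exact: (hf j).1.
exists e => // s /andP[s0 se] j; apply: (hf j).2; rewrite s0 /=.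
by apply: (lt_trans se); apply: he; apply: map_f; rewrite mem_enum.
Qed.

Lemma cos_sin_pos (a b : R) : 0 < a ->
  exists2 e : R, 0 < e & forall s, 0 < s < e -> 0 < cos s * a + sin s * b.
Proof.
move=> a0.
have h : {for 0, continuous (fun s : R => cos s * a + sin s * b)}.
  apply: cvgD; apply: cvgM; try exact: cvg_cst.
    exact: continuous_cos.
  exact: continuous_sin.
have := @cvgr_gt _ _ _ _ _ _ h 0.
rewrite cos0 sin0 mul0r mul1r addr0 => /(_ _ a0)/nbhs_ballP[e /= e0 he].
exists e => // s /andP[s0 se]; apply: he.
by rewrite /ball /= sub0r normrN gtr0_norm.
Qed.

(** The contact just beside [t] is the lexicographic maximum: extreme in direction [t], and among
    those vertices furthest in the orthogonal direction towards which [k] turns. *)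
Lemma local_contact (k t : R) : k = 1 \/ k = -1 ->
  exists i, supports t i /\
   exists2 e : R, 0 < e & forall s, 0 < s < e -> forall j, supports (t + k * s) j <-> j = i.
Proof.
move=> hk.
have skE s : sin (k * s) = k * sin s by case: hk => ->; rewrite ?mul1r // !mulN1r sinN.
have ckE s : cos (k * s) = cos s by case: hk => ->; rewrite ?mul1r // !mulN1r cosN.
case: (arg_maxP (fun i => dot_dir t (p i)) (isT : xpredT i0)) => i1 _ m1.
have h1 : dot_dir t (p i1) == dot_dir t (p i1) by [].
case: (@arg_maxP _ _ I i1 (fun i => dot_dir t (p i) == dot_dir t (p i1))
   (fun i => k * dot_dir (t + pi / 2) (p i)) h1) => i /eqP ei mi.
exists i; split; first by move=> j; rewrite ei; exact: m1.
have [|e e0 he] := @small_all (fun j s => j != i -> dot_dir (t + k * s) (p j) < dot_dir (t + k * s) (p i)).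
  move=> j; have [->|ji] := eqVneq j i; first by exists 1 => // s _; rewrite eqxx.
  have dE s : dot_dir (t + k * s) (p i) - dot_dir (t + k * s) (p j) =
      cos s * (dot_dir t (p i) - dot_dir t (p j)) +
      sin s * (k * dot_dir (t + pi / 2) (p i) - k * dot_dir (t + pi / 2) (p j)).
    by rewrite !(dot_dirD t (k * s)) ckE skE; ring.
  have [dj|dj] := eqVneq (dot_dir t (p j)) (dot_dir t (p i1)).
    exists pi; first exact: pi_gt0.
    move=> s sp _; rewrite -subr_gt0 dE ei dj subrr mulr0 add0r.
    apply: mulr_gt0; first exact: sin_gt0_pi.
    have mij : k * dot_dir (t + pi / 2) (p j) <= k * dot_dir (t + pi / 2) (p i).
      by apply: mi; rewrite dj.
    rewrite subr_gt0 lt_neqAle mij andbT.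
    apply: contra_neq ji => e; apply/p_inj/(@dot_dir_inj t); first by rewrite dj ei.
    by apply: mulfI e; case: hk => ->; rewrite ?oppr_eq0 oner_eq0.
  have [|e e0 he] := @cos_sin_pos (dot_dir t (p i) - dot_dir t (p j))
     (k * dot_dir (t + pi / 2) (p i) - k * dot_dir (t + pi / 2) (p j)).
    by rewrite subr_gt0 ei lt_neqAle dj; exact: m1.
  by exists e => // s /he; rewrite -dE subr_gt0.
exists e => // s hs j; split=> [hj|->{j} j].
  apply/eqP; apply: contraT => ji; have := he s hs j ji.
  by rewrite ltNge (hj i).
by have [->//|ji] := eqVneq j i; exact/ltW/he.
Qed.

End Supports.

(** * Existence of a circumscribed wedge *)

Section Near.
Variables (R : realType) (I : Type) (supp : R -> I -> Prop) (W : I -> R).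
Local Notation pi := (@pi R).
Hypothesis per : turn_periodic pi supp.
Hypothesis W_inj : injective W.
Hypothesis loc : forall k t, k = 1 \/ k = -1 -> exists i, supp t i /\
   exists2 e : R, 0 < e & forall s, 0 < s < e -> forall j, supp (t + k * s) j <-> j = i.

(* [t] and [t + 5 * pi / 6] are the outer normals of the sides of a wedge of angle
   pi / 6.  With [rc], [lc] the contacts just after and just before a direction, the
   comparison of the times of [rc f] and [rc (f + 5 * pi / 6)] changes at the
   supremum [ph] below. *)
Lemma near_triple_exists :
  (exists t i, supp t i /\ supp (t + 5 * pi / 6) i) \/
  exists k mu A B A', [/\ k = 1 \/ k = -1, near_triple pi supp W k mu A B A',
     supp (mu - k * (pi / 2)) A, supp (mu - k * (pi / 2)) A' & supp (mu + k * (2 * pi / 3)) B].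
Proof.
have p0 := @pi_gt0 R.
have [[t [i h]]|apex] := pselect (exists t i, supp t i /\ supp (t + 5 * pi / 6) i).
  by left; exists t, i.
right.
have [rc Hrc] := choice (fun t => @loc 1 t (or_introl erefl)).
have [lc Hlc] := choice (fun t => @loc (-1) t (or_intror erefl)).
pose q := 5 * pi / 6.
have noapex t i : supp t i -> supp (t + q) i -> False.
  by move=> h1 h2; apply: apex; exists t, i.
have rcE t : exists2 e : R, 0 < e & forall s, 0 < s < e -> rc (t + s) = rc t.
  have [_ [e e0 h]] := Hrc t; exists e => // s /h h'; apply/h'; rewrite mul1r.
  exact: (Hrc _).1.
have lcE t : exists2 e : R, 0 < e & forall s, 0 < s < e -> rc (t - s) = lc t.
  have [_ [e e0 h]] := Hlc t; exists e => // s /h h'; apply/h'; rewrite mulN1r.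
  exact: (Hrc _).1.
have rc_per t : rc (t + 2 * pi) = rc t.
  have [_ [e e0 h]] := Hrc t; have [_ [e' e'0 h']] := Hrc (t + 2 * pi).
  have := @small_lt R [:: e; e']; rewrite /= e0 e'0 => -[//|s s0 /and3P[s1 s2 _]].
  have /h' h2 : 0 < s < e' by rewrite s0.
  have /h h1 : 0 < s < e by rewrite s0.
  by apply/h1/per; rewrite addrAC; apply/h2.
pose Q f := W (rc (f + q)) < W (rc f).
pose g (n : nat) := n%:R * q.
have gS n : g n.+1 = g n + q by rewrite /g -addn1 natrD; ring.
have g12 : rc (g 12) = rc (g 0).
  have -> : g 12 = 0 + 2 * pi + 2 * pi + 2 * pi + 2 * pi + 2 * pi by rewrite /g /q; field.
  by rewrite !rc_per /g mul0r.
(* Otherwise the times would not decrease around a closed cycle, so they would all be equal, and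
   [g 0] and [g 1] would share a contact. *)
have [n1 Qn1] : exists2 n, (n < 12)%N & Q (g n).
  apply: contrapT => /forall2NP h.
  have le n : (n < 12)%N -> W (rc (g n)) <= W (rc (g n.+1)).
    by move=> hn; have [//|/negP] := h n; rewrite -leNgt -gS.
  have mono m : (m <= 11)%N -> W (rc (g 1)) <= W (rc (g m.+1)).
    elim: m => [//|m IH] hm; apply: (le_trans (IH (ltnW hm))); exact: le.
  have : W (rc (g 1)) <= W (rc (g 0)) by rewrite -g12; exact: (mono 11).
  have := le 0 isT => h1 h2.
  have /W_inj e : W (rc (g 0)) = W (rc (g 1)) by apply/eqP; rewrite eq_le h1 h2.
  apply: (@noapex (g 0) (rc (g 0))); first exact: (Hrc _).1.
  by rewrite -gS e; exact: (Hrc _).1.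
have [n2 hn2 NQn2] : exists2 n, (n < 12)%N & ~ Q (g n).
  apply: contrapT => /forall2NP h.
  have lt n : (n < 12)%N -> W (rc (g n.+1)) < W (rc (g n)).
    by move=> hn; have [//|/contrapT] := h n; rewrite gS.
  have mono m : (m <= 11)%N -> W (rc (g m.+1)) < W (rc (g 0)).
    elim: m => [|m IH] hm; first exact: lt.
    by apply: lt_trans (IH (ltnW hm)); exact: lt.
  by have := mono 11 isT; rewrite g12 ltxx.
move=> Qn; set al := g n1 in Qn.
(* Five full turns move [g n2] beyond [al], because 11 * 5 / 6 < 10. *)
have [be hbe NQ] : exists2 be, al < be & ~ Q be.
  exists (g n2 + 2 * pi + 2 * pi + 2 * pi + 2 * pi + 2 * pi).
    have : (n1%:R : R) <= 11 by rewrite ler_nat -ltnS.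
    have : 0 <= (n2%:R : R) by [].
    rewrite /al /g /q => h1 h2.
    have : 0 <= n2%:R * (5 * pi / 6) by apply: mulr_ge0; lra.
    have : n1%:R * (5 * pi / 6) <= 11 * (5 * pi / 6) by apply: ler_wpM2r; lra.
    lra.
  by move: NQn2; rewrite /Q ![_ + 2 * pi + q]addrAC !rc_per.
pose S := [set f | al <= f <= be /\ Q f]%classic.
have supS : has_sup S.
  split; first by exists al; split=> //; rewrite lexx ltW.
  by exists be => f [/andP[]].
pose ph := sup S.
have ubS : ubound S ph by exact: sup_upper_bound.
have ph_be : ph <= be by apply: ge_sup => [|f [/andP[]]] //; exact: supS.1.
have al_ph : al <= ph by apply: ubS; split=> //; rewrite lexx ltW.
(* [Q] is locally constant to the right of every direction, so it cannot hold at the supremum. *)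
have NQph : ~ Q ph.
  move=> Qph; have ltbe : ph < be.
    by rewrite lt_neqAle ph_be andbT; apply/eqP => e; apply: NQ; rewrite -e.
  have [e e0 he] := rcE ph; have [e' e'0 he'] := rcE (ph + q).
  have := @small_lt R [:: e; e'; be - ph]; rewrite /= e0 e'0 subr_gt0 ltbe.
  case=> // s s0 /and4P[s1 s2 s3 _].
  have : ph + s <= ph.
    apply: ubS; split; first by apply/andP; split; lra.
    by rewrite /Q he ?s0 // addrAC he' ?s0.
  lra.
have [e e0 he] := lcE ph; have [e' e'0 he'] := lcE (ph + q).
(* [Q] holds at directions arbitrarily close to [ph] on its left, where [rc] takes the value
   [lc ph]. *)
have Ql : W (lc (ph + q)) < W (lc ph).
  have := @small_lt R [:: e; e']; rewrite /= e0 e'0.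
  case=> // s s0 /and3P[s1 s2 _].
  have [f [fab Qf] hf] := sup_adherent s0 supS.
  have fph : f <= ph by apply: ubS.
  have fne : f != ph by apply/eqP => efp; apply: NQph; rewrite -efp.
  have flt : f < ph by rewrite lt_neqAle fne.
  have hs : 0 < ph - f < e by rewrite -/ph in hf; apply/andP; split; lra.
  have hs' : 0 < ph - f < e' by rewrite -/ph in hf; apply/andP; split; lra.
  move: Qf; rewrite /Q.
  have -> : f = ph - (ph - f) by ring.
  by rewrite addrAC he // he'.
have Qr : W (rc ph) < W (rc (ph + q)).
  rewrite lt_neqAle; apply/andP; split; last by rewrite leNgt; apply/negP.
  apply/eqP => /W_inj e1; apply: (@noapex ph (rc ph)); first exact: (Hrc _).1.
  by rewrite e1; exact: (Hrc _).1.
have rside t : side_supp supp 1 t (rc t).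
  by have [_ [d d0 h]] := Hrc t; exists d => // s hs; apply/h.
have lside t : side_supp supp (-1) t (lc t).
  by have [_ [d d0 h]] := Hlc t; exists d => // s hs; apply/h.
have back k t t' i : t = t' + 2 * pi -> side_supp supp k t i -> side_supp supp k t' i.
  move=> -> [d d0 h]; exists d => // s /h; rewrite addrAC; exact: (per _ _).2.
have back' t t' i : t = t' + 2 * pi -> supp t i -> supp t' i.
  by move=> -> h; apply/per.
(* If [lc ph] is met before [rc (ph + q)], it is the middle contact and the first side has normal
   [ph + q]. Otherwise [rc (ph + q)] is the middle one, and the wedge has the opposite
   orientation. *)
have [c|c] := ltP (W (lc ph)) (W (rc (ph + q))).
  exists 1, (ph - 2 * pi / 3), (lc (ph + q)), (lc ph), (rc (ph + q)).
  split; first by left.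
  - split=> //.
    + by apply: (back _ _ _ _ _ (lside (ph + q))); rewrite /q; field.
    + by apply: (back _ _ _ _ _ (rside (ph + q))); rewrite /q; field.
    + have -> : ph - 2 * pi / 3 + 1 * (2 * pi / 3) = ph by ring.
      exact: lside.
  - by apply: (back' _ _ _ _ (Hlc (ph + q)).1); rewrite /q; field.
  - by apply: (back' _ _ _ _ (Hrc (ph + q)).1); rewrite /q; field.
  - have -> : ph - 2 * pi / 3 + 1 * (2 * pi / 3) = ph by ring.
    exact: (Hlc _).1.
exists (-1), (ph - pi / 2), (rc ph), (rc (ph + q)), (lc ph).
have e1 : ph - pi / 2 - -1 * (pi / 2) = ph by field.
split; first by right.
- split=> //.
  + by rewrite opprK e1; exact: rside.
  + by rewrite e1; exact: lside.
  + rewrite opprK.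
    by apply: (back _ _ _ _ _ (rside (ph + q))); rewrite /q; field.
  + rewrite lt_neqAle c andbT; apply/eqP => /W_inj e2.
    apply: (@noapex ph (lc ph)); first exact: (Hlc _).1.
    by rewrite -e2; exact: (Hrc _).1.
- by rewrite e1; exact: (Hrc _).1.
- by rewrite e1; exact: (Hlc _).1.
- by apply: (back' _ _ _ _ (Hrc (ph + q)).1); rewrite /q; field.
Qed.

End Near.

(** * Non-crossing paths *)

Section Planar.
Variable R : realType.
Local Notation pi := (@pi R).
Implicit Types a b c : R * R.

(** Twice the signed area of the triangle, positive in counterclockwise order. *)
Definition cross3 a b c : R := (b.1 - a.1) * (c.2 - a.2) - (b.2 - a.2) * (c.1 - a.1).

Definition dist2 a b : R := norm2 (a.1 - b.1) (a.2 - b.2).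

Lemma dist2C a b : dist2 a b = dist2 b a.
Proof. exact: norm2_sym. Qed.

Lemma cross3_rot a b c : cross3 a b c = cross3 b c a.
Proof. by rewrite /cross3; ring. Qed.

Lemma cross3_dir t a b c : cross3 a b c =
  (dot_dir t b - dot_dir t a) * (dot_dir (t + pi / 2) c - dot_dir (t + pi / 2) a) -
  (dot_dir (t + pi / 2) b - dot_dir (t + pi / 2) a) * (dot_dir t c - dot_dir t a).
Proof.
rewrite /dot_dir cosDpihalf sinDpihalf /cross3 -[LHS]mulr1 -(cos2Dsin2 t); ring.
Qed.

Lemma ccw_above s t a b c : s < t -> t < s + pi ->
  dot_dir s c <= dot_dir s b -> dot_dir s a <= dot_dir s c ->
  dot_dir t a <= dot_dir t c -> dot_dir t b <= dot_dir t c -> 0 <= cross3 a b c.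
Proof.
move=> st ts h1 h2 h3 h4; have s0 : 0 < sin (t - s) by apply: sin_gt0_pi; apply/andP; split; lra.
have D v := dot_dirD s (t - s) v; rewrite addrC subrK in D.
rewrite !D in h3 h4; rewrite -(pmulr_rge0 _ s0) (cross3_dir s).
set k := cos _ in h3 h4; set z := sin _ in s0 h3 h4 *.
set an := dot_dir s a in h1 h2 h3 h4 *; set bn := dot_dir s b in h1 h2 h3 h4 *.
set cn := dot_dir s c in h1 h2 h3 h4 *.
set at_ := dot_dir _ a in h3 h4 *; set bt := dot_dir _ b in h3 h4 *; set ct := dot_dir _ c in h3 h4 *.
have e1 : 0 <= (cn - an) * (k * (cn - bn) + z * (ct - bt)) by apply: mulr_ge0; lra.
have e2 : 0 <= (bn - cn) * (k * (cn - an) + z * (ct - at_)) by apply: mulr_ge0; lra.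
lra.
Qed.

Lemma ccw_below s t a b c : t < s -> s < t + pi ->
  dot_dir s a <= dot_dir s b -> dot_dir s c <= dot_dir s a ->
  dot_dir t b <= dot_dir t a -> dot_dir t c <= dot_dir t a -> 0 <= cross3 a b c.
Proof.
move=> st ts h1 h2 h3 h4; have s0 : 0 < sin (s - t) by apply: sin_gt0_pi; apply/andP; split; lra.
have D v := dot_dirD s (t - s) v; rewrite addrC subrK in D.
rewrite !D in h3 h4; rewrite -(pmulr_rge0 _ s0) (cross3_dir s).
have eS : sin (t - s) = - sin (s - t) by rewrite -sinN opprB.
rewrite eS in h3 h4.
set k := cos _ in h3 h4; set z := sin _ in s0 h3 h4 *.
set an := dot_dir s a in h1 h2 h3 h4 *; set bn := dot_dir s b in h1 h2 h3 h4 *.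
set cn := dot_dir s c in h1 h2 h3 h4 *.
set at_ := dot_dir _ a in h3 h4 *; set bt := dot_dir _ b in h3 h4 *; set ct := dot_dir _ c in h3 h4 *.
have e1 : 0 <= (an - cn) * (k * (an - bn) + z * (bt - at_)) by apply: mulr_ge0; lra.
have e2 : 0 <= (bn - an) * (k * (an - cn) + z * (ct - at_)) by apply: mulr_ge0; lra.
lra.
Qed.

Section Three.
Variables (t1 t2 t3 : R) (a b c : R * R).
Hypotheses (ab1 : dot_dir t1 b <= dot_dir t1 a) (ac1 : dot_dir t1 c <= dot_dir t1 a).
Hypotheses (ba2 : dot_dir t2 a <= dot_dir t2 b) (bc2 : dot_dir t2 c <= dot_dir t2 b).
Hypotheses (ca3 : dot_dir t3 a <= dot_dir t3 c) (cb3 : dot_dir t3 b <= dot_dir t3 c).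

Lemma ccw_mid : t1 < t2 -> t2 < t3 -> t2 < t1 + pi -> t3 < t2 + pi -> 0 <= cross3 a b c.
Proof.
move=> h1 h2 h3 h4; have [h|h] := lerP (dot_dir t2 a) (dot_dir t2 c).
  exact: (@ccw_above t2 t3).
exact: (@ccw_below t2 t1 _ _ _ h1 h3 _ (ltW h)).
Qed.
End Three.

Lemma ccw_contacts t1 t2 t3 a b c : t1 < t2 -> t2 < t3 -> t3 < t1 + 2 * pi ->
  dot_dir t1 b <= dot_dir t1 a -> dot_dir t1 c <= dot_dir t1 a ->
  dot_dir t2 a <= dot_dir t2 b -> dot_dir t2 c <= dot_dir t2 b ->
  dot_dir t3 a <= dot_dir t3 c -> dot_dir t3 b <= dot_dir t3 c -> 0 <= cross3 a b c.
Proof.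
move=> h1 h2 h3 a1 a2 a3 a4 a5 a6; have p0 := @pi_gt0 R.
(* At most one of the three cyclic gaps reaches a half turn; a cyclic shift puts it last. *)
have [g1|g1] := ltP t2 (t1 + pi); last first.
  rewrite cross3_rot; apply: (@ccw_mid t2 t3 (t1 + 2 * pi)); rewrite ?dot_dir_turn //; lra.
have [g2|g2] := ltP t3 (t2 + pi); last first.
  rewrite cross3_rot cross3_rot.
  by apply: (@ccw_mid t3 (t1 + 2 * pi) (t2 + 2 * pi)); rewrite ?dot_dir_turn //; lra.
exact: (@ccw_mid t1 t2 t3).
Qed.

Lemma dot_dirB t (a b : R * R) : dot_dir t (a.1 - b.1, a.2 - b.2) = dot_dir t a - dot_dir t b.
Proof. by rewrite /dot_dir /=; ring. Qed.

(** As a function of the direction, the component of a - b is a sinusoid, which cannot have signs +,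
    -, +, - within one turn unless it vanishes. *)
Lemma two_contacts t1 t2 t3 t4 a b : t1 < t2 -> t2 < t3 -> t3 < t4 -> t4 < t1 + 2 * pi ->
  dot_dir t1 b <= dot_dir t1 a -> dot_dir t2 a <= dot_dir t2 b ->
  dot_dir t3 b <= dot_dir t3 a -> dot_dir t4 a <= dot_dir t4 b -> a = b.
Proof.
move=> h1 h2 h3 h4 l1 l2 l3 l4; pose v := (a.1 - b.1, a.2 - b.2).
have g1 : 0 <= dot_dir t1 v by rewrite dot_dirB subr_ge0.
have g2 : 0 <= - dot_dir t2 v by rewrite dot_dirB opprB subr_ge0.
have g3 : 0 <= dot_dir t3 v by rewrite dot_dirB subr_ge0.
have g4 : 0 <= - dot_dir t4 v by rewrite dot_dirB opprB subr_ge0.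
clear l1 l2 l3 l4.
have p0 := @pi_gt0 R.
have zero x y : x < y -> y < x + pi -> dot_dir x v = 0 -> dot_dir y v = 0 -> a = b.
  move=> xy yx e1 e2; have s0 : 0 < sin (y - x) by apply: sin_gt0_pi; apply/andP; split; lra.
  move: e2; have D := dot_dirD x (y - x) v; rewrite addrC subrK in D.
  rewrite D e1 mulr0 add0r => /eqP; rewrite mulf_eq0 gt_eqF //= => /eqP e2.
  apply: (@dot_dir_inj _ x); apply/eqP; rewrite -subr_eq0 -dot_dirB; exact/eqP.
have arc (k : R) x y z : x < y -> y < z -> z < x + pi -> k = 1 \/ k = -1 ->
    0 <= k * dot_dir x v -> 0 <= - (k * dot_dir y v) -> 0 <= k * dot_dir z v -> a = b.
  move=> xy yz zx hk k1 k2 k3.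
  have s1 : 0 < sin (z - x) by apply: sin_gt0_pi; apply/andP; split; lra.
  have s2 : 0 < sin (z - y) by apply: sin_gt0_pi; apply/andP; split; lra.
  have s3 : 0 < sin (y - x) by apply: sin_gt0_pi; apply/andP; split; lra.
  have B := dot_dir_between x y z v.
  have m1 : 0 <= sin (z - y) * (k * dot_dir x v) by apply: mulr_ge0 => //; exact: ltW.
  have m2 : 0 <= sin (y - x) * (k * dot_dir z v) by apply: mulr_ge0 => //; exact: ltW.
  have m3 : 0 <= sin (z - x) * - (k * dot_dir y v) by apply: mulr_ge0 => //; exact: ltW.
  have m4 : sin (z - x) * (k * dot_dir y v) = sin (z - y) * (k * dot_dir x v) + sin (y - x) * (k * dot_dir z v).
    by rewrite mulrCA B; ring.
  have z1 : sin (z - y) * (k * dot_dir x v) = 0 by lra.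
  have z2 : sin (z - x) * (k * dot_dir y v) = 0 by lra.
  have k0 : k == 0 = false by case: hk => ->; rewrite ?oppr_eq0 oner_eq0.
  move/eqP: z1; rewrite !mulf_eq0 k0 gt_eqF //= => /eqP z1.
  move/eqP: z2; rewrite !mulf_eq0 k0 gt_eqF //= => /eqP z2.
  by apply: (zero x y) => //; lra.
(* Three cyclically consecutive directions fit in less than a half turn, unless the four form two
   antipodal pairs. *)
have [c|c] := ltP t3 (t1 + pi).
  by apply: (arc 1 t1 t2 t3) => //; rewrite ?mul1r //; left.
have [c'|c'] := ltP (t1 + 2 * pi) (t3 + pi).
  by apply: (arc 1 t3 t4 (t1 + 2 * pi)) => //; rewrite ?dot_dir_turn ?mul1r //; left.
have e3 : t3 = t1 + pi by lra.
have half t : dot_dir (t + pi) v = - dot_dir t v.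
  by rewrite /dot_dir (cosDpi t) (sinDpi t); ring.
have [d|d] := ltP t4 (t2 + pi).
  by apply: (arc (-1) t2 t3 t4) => //; rewrite ?mulN1r ?opprK //; right.
have [d'|d'] := ltP (t2 + 2 * pi) (t4 + pi).
  by apply: (arc (-1) t4 (t1 + 2 * pi) (t2 + 2 * pi) h4 _ _ (or_intror erefl));
    rewrite ?dot_dir_turn ?mulN1r ?opprK //; lra.
have e4 : t4 = t2 + pi by lra.
move: g3 g4; rewrite e3 e4 !half => g3 g4.
by apply: (zero t1 t2) => //; lra.
Qed.

Lemma norm2_tri_strict (x y u v : R) : x * v - y * u != 0 ->
  norm2 (x + u) (y + v) < norm2 x y + norm2 u v.
Proof.
move=> h; rewrite lt_neqAle norm2_tri andbT; apply: contra_neq h => e.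
have h1 := norm2_sq (x + u) (y + v); rewrite e in h1.
have h2 := norm2_sq x y; have h3 := norm2_sq u v.
have h4 : norm2 x y * norm2 u v = x * u + y * v by lra.
have h5 : (norm2 x y * norm2 u v) ^+ 2 = (x * u + y * v) ^+ 2 by rewrite h4.
rewrite exprMn h2 h3 in h5.
apply/eqP; rewrite -sqrf_eq0; apply/eqP; lra.
Qed.

(** The quadrilateral is convex, so its diagonals meet, at [c] with ratios [l] and [k]. Two triangle
    inequalities through [c], one of them strict, bound the two opposite sides. *)
Lemma crossing_shorter v m v' m' :
  0 < cross3 v m v' -> 0 < cross3 m v' m' -> 0 < cross3 v' m' v -> 0 < cross3 m' v m ->
  dist2 v m + dist2 v' m' < dist2 v v' + dist2 m m'.
Proof.
move=> h1 h2 h3 h4.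
pose D := cross3 m v' m' + cross3 m' v m.
have D0 : 0 < D by rewrite addr_gt0.
pose l := cross3 m' v m / D; pose k := cross3 v m v' / D.
have ED : D = cross3 v m v' + cross3 v' m' v by rewrite /D /cross3; ring.
have l0 : 0 < l by rewrite divr_gt0.
have l1 : 1 - l = cross3 m v' m' / D by rewrite /l /D; field; exact: lt0r_neq0.
have l1' : 0 < 1 - l by rewrite l1 divr_gt0.
have k0 : 0 < k by rewrite divr_gt0.
have k1 : 1 - k = cross3 v' m' v / D by rewrite /k ED; field; rewrite -ED; exact: lt0r_neq0.
have k1' : 0 < 1 - k by rewrite k1 divr_gt0.
pose c : R * R := (v.1 + l * (v'.1 - v.1), v.2 + l * (v'.2 - v.2)).
have ec1 : c.1 = m.1 + k * (m'.1 - m.1).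
  by rewrite /c /l /k /= /D /cross3; field; rewrite -/(cross3 m v' m'); move: (lt0r_neq0 D0); rewrite /D /cross3.
have ec2 : c.2 = m.2 + k * (m'.2 - m.2).
  by rewrite /c /l /k /= /D /cross3; field; move: (lt0r_neq0 D0); rewrite /D /cross3.
have scale (r x y : R) : 0 < r -> norm2 (r * x) (r * y) = r * norm2 x y.
  move=> r0; rewrite /norm2 !exprMn -mulrDr sqrtrM ?sqr_ge0 // sqrtr_sqr gtr0_norm //.
have dvv : dist2 v v' = dist2 v c + dist2 c v'.
  rewrite /dist2 /c /=.
  have -> : norm2 (v.1 - (v.1 + l * (v'.1 - v.1))) (v.2 - (v.2 + l * (v'.2 - v.2))) = l * norm2 (v.1 - v'.1) (v.2 - v'.2).
    by rewrite -scale //; congr norm2; ring.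
  have -> : norm2 (v.1 + l * (v'.1 - v.1) - v'.1) (v.2 + l * (v'.2 - v.2) - v'.2) = (1 - l) * norm2 (v.1 - v'.1) (v.2 - v'.2).
    by rewrite -scale //; congr norm2; ring.
  ring.
have dmm : dist2 m m' = dist2 c m + dist2 c m'.
  rewrite /dist2 ec1 ec2.
  have -> : norm2 (m.1 + k * (m'.1 - m.1) - m.1) (m.2 + k * (m'.2 - m.2) - m.2) = k * norm2 (m.1 - m'.1) (m.2 - m'.2).
    by rewrite -scale // -norm2N; congr norm2; ring.
  have -> : norm2 (m.1 + k * (m'.1 - m.1) - m'.1) (m.2 + k * (m'.2 - m.2) - m'.2) = (1 - k) * norm2 (m.1 - m'.1) (m.2 - m'.2).
    by rewrite -scale //; congr norm2; ring.
  ring.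
have t1 : dist2 v m < dist2 v c + dist2 c m.
  rewrite /dist2.
  have -> : v.1 - m.1 = (v.1 - c.1) + (c.1 - m.1) by ring.
  have -> : v.2 - m.2 = (v.2 - c.2) + (c.2 - m.2) by ring.
  apply: norm2_tri_strict.
  have -> : (v.1 - c.1) * (c.2 - m.2) - (v.2 - c.2) * (c.1 - m.1) = - (l * cross3 v m v').
    by rewrite /c /cross3 /=; ring.
  by rewrite oppr_eq0 mulf_neq0 // gt_eqF.
have t2 : dist2 v' m' <= dist2 c v' + dist2 c m'.
  rewrite (dist2C c v'); exact: norm2_dist_tri.
lra.
Qed.

End Planar.

Lemma bool_change (f : nat -> bool) (m n : nat) : (m <= n)%N -> f m != f n ->
  exists k, [/\ (m <= k)%N, (k < n)%N & f k != f k.+1].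
Proof.
move=> /subnKC <-; elim: (n - m)%N => [|d IH]; first by rewrite addn0 eqxx.
rewrite addnS; have [<-|h] := eqVneq (f (m + d)%N) (f (m + d).+1).
  by move=> /IH[k [h1 h2 h3]]; exists k; split=> //; apply: leq_trans h2 _; rewrite leqnSn.
by move=> _; exists (m + d)%N; rewrite leq_addr leqnn h.
Qed.

(** * The crossing argument *)

Section NoAlternation.
Variables (R : realType) (N : nat) (q : nat -> R * R).
Local Notation pi := (@pi R).

Definition contact (t : R) (i : nat) : Prop :=
  (i < N)%N /\ forall j, (j < N)%N -> dot_dir t (q j) <= dot_dir t (q i).

Hypothesis strict : forall i, (i < N)%N -> exists t, forall j, (j < N)%N -> j != i ->
  dot_dir t (q j) < dot_dir t (q i).

Hypothesis no_swap : forall i j, (i < j)%N -> (j.+1 < N)%N ->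
  dist2 (q i) (q i.+1) + dist2 (q j) (q j.+1) <= dist2 (q i) (q j) + dist2 (q i.+1) (q j.+1).

Lemma contact_turn t i : contact t i <-> contact (t + 2 * pi) i.
Proof. by split=> -[h k]; split=> // j hj; have := k j hj; rewrite !dot_dir_turn. Qed.

(** On a common line, one of the three points lies between the other two and is not strictly
    extreme; [r] is the position of the third point relative to the first two. *)
Lemma cross3_neq0 i j k : (i < N)%N -> (j < N)%N -> (k < N)%N ->
  i != j -> j != k -> i != k -> cross3 (q i) (q j) (q k) != 0.
Proof.
move=> hi hj hk ij jk ik; apply/eqP => e.
have [ti si] := strict hi; have [tj sj] := strict hj; have [tk sk] := strict hk.
have lin t : (dot_dir t (q j) - dot_dir t (q i)) * (dot_dir (t + pi / 2) (q k) - dot_dir (t + pi / 2) (q i)) =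
   (dot_dir (t + pi / 2) (q j) - dot_dir (t + pi / 2) (q i)) * (dot_dir t (q k) - dot_dir t (q i)).
  by apply/eqP; rewrite -subr_eq0 -cross3_dir e.
have u0 : (q j).1 - (q i).1 != 0 \/ (q j).2 - (q i).2 != 0.
  have [h1|] := eqVneq ((q j).1 - (q i).1) 0; last by left.
  have [h2|] := eqVneq ((q j).2 - (q i).2) 0; last by right.
  have := sj i hi ij; suff -> : q i = q j by rewrite ltxx.
  by case: (q i) (q j) h1 h2 => [a b] [c d] /= /subr0_eq -> /subr0_eq ->.
have [r [r1 r2]] : exists r, (q k).1 - (q i).1 = r * ((q j).1 - (q i).1) /\
     (q k).2 - (q i).2 = r * ((q j).2 - (q i).2).
  move: e; rewrite /cross3 => e.
  case: u0 => u0.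
    exists (((q k).1 - (q i).1) / ((q j).1 - (q i).1)); split; first by rewrite divfK.
    apply: (mulfI u0); rewrite mulrA mulrCA divff // mulr1; lra.
  exists (((q k).2 - (q i).2) / ((q j).2 - (q i).2)); split; last by rewrite divfK.
  apply: (mulfI u0); rewrite mulrA mulrCA divff // mulr1; lra.
have dr t : dot_dir t (q k) - dot_dir t (q i) = r * (dot_dir t (q j) - dot_dir t (q i)).
  rewrite /dot_dir; transitivity (((q k).1 - (q i).1) * cos t + ((q k).2 - (q i).2) * sin t); first by ring.
  by rewrite r1 r2; ring.
have a1 := si j hj; rewrite eq_sym in a1; have {}a1 := a1 ij.
have a2 := si k hk; rewrite eq_sym in a2; have {}a2 := a2 ik.
have a3 := sj i hi ij; have a4 := sj k hk; rewrite eq_sym in a4; have {}a4 := a4 jk.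
have a5 := sk i hi ik; have a6 := sk j hj jk.
have b1 := dr ti; have b2 := dr tj; have b3 := dr tk.
have r0 : 0 < r.
  have : 0 < r * (dot_dir ti (q i) - dot_dir ti (q j)) by lra.
  by rewrite pmulr_lgt0 // subr_gt0.
have r1' : r < 1.
  have : 0 < (1 - r) * (dot_dir tj (q j) - dot_dir tj (q i)) by lra.
  by rewrite pmulr_lgt0 ?subr_gt0.
have c0 : 0 < dot_dir tk (q j) - dot_dir tk (q i).
  have : 0 < r * (dot_dir tk (q j) - dot_dir tk (q i)) by lra.
  by rewrite pmulr_rgt0.
have : (r - 1) * (dot_dir tk (q j) - dot_dir tk (q i)) < 0 by rewrite pmulr_llt0 // subr_lt0.
lra.
Qed.

Lemma contact_ccw t1 t2 t3 i j k : t1 < t2 -> t2 < t3 -> t3 < t1 + 2 * pi ->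
  contact t1 i -> contact t2 j -> contact t3 k -> i != j -> j != k -> i != k ->
  0 < cross3 (q i) (q j) (q k).
Proof.
move=> h1 h2 h3 [hi ci] [hj cj] [hk ck] ij jk ik.
rewrite lt_neqAle eq_sym cross3_neq0 //=.
by apply: (@ccw_contacts _ t1 t2 t3) => //; [exact: ci|exact: ci|exact: cj|exact: cj|exact: ck|exact: ck].
Qed.

Lemma interlaced_shorter t1 t2 t3 t4 v m v' m' : t1 < t2 -> t2 < t3 -> t3 < t4 -> t4 < t1 + 2 * pi ->
  contact t1 v -> contact t2 m -> contact t3 v' -> contact t4 m' ->
  uniq [:: v; m; v'; m'] ->
  dist2 (q v) (q m) + dist2 (q v') (q m') < dist2 (q v) (q v') + dist2 (q m) (q m').
Proof.
move=> h1 h2 h3 h4 c1 c2 c3 c4 /=; rewrite !inE !negb_or andbT.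
move=> /andP[/and3P[a1 a2 a3] /andP[/andP[a4 a5] a6]].
have c1' := (contact_turn _ _).1 c1; have c2' := (contact_turn _ _).1 c2.
by apply: crossing_shorter;
  [apply: (@contact_ccw t1 t2 t3)|apply: (@contact_ccw t2 t3 t4)|
   apply: (@contact_ccw t3 t4 (t1 + 2 * pi))|apply: (@contact_ccw t4 (t1 + 2 * pi) (t2 + 2 * pi))]; rewrite // 1?eq_sym //; lra.
Qed.

Lemma contact_neq t t' i j : contact t i -> (forall k, (k < N)%N -> k != j -> dot_dir t' (q k) < dot_dir t' (q j)) ->
  i != j -> (j < N)%N -> forall m : int, t != t' + 2 * pi * m%:~R.
Proof.
move=> [hi ci] s ij hj m; apply/eqP => e.
have per : turn_periodic pi (fun t (_ : unit) => dot_dir t (q i) < dot_dir t (q j)).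
  by move=> u _; rewrite !dot_dir_turn.
have := @supp_turns _ pi _ _ t' tt m per (s i hi ij); rewrite -e.
by rewrite ltNge ci.
Qed.

(** The direction in which [v] is strictly extreme is moved into the window. No other vertex is
    extreme there, which makes later comparisons of angles strict. *)
Lemma angle_in lo t v : contact lo t -> (v < N)%N -> v != t ->
  exists u, [/\ lo < u, u < lo + 2 * pi, contact u v &
    forall t' i, contact t' i -> i != v -> t' != u].
Proof.
move=> clo hv vt; have [u0 s0] := strict hv.
have [m /andP[h1 h2]] := turn_into (@pi_gt0 R) u0 lo.
have ne t' i : contact t' i -> i != v -> t' != u0 + 2 * pi * m%:~R.
  by move=> c iv; exact: contact_neq c s0 iv hv m.
exists (u0 + 2 * pi * m%:~R); split=> //.
- by rewrite lt_neqAle h1 andbT; apply: (ne _ t) => //; rewrite eq_sym.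
- apply: (@supp_turns _ pi _ contact); first by move=> ? ?; exact: contact_turn.
  split=> // j hj; have [->//|jv] := eqVneq j v; exact/ltW/s0.
Qed.

Lemma contacts_no_alternation t1 t2 t3 t4 w x y z :
  t1 < t2 -> t2 < t3 -> t3 < t4 -> t4 < t1 + 2 * pi ->
  contact t1 w -> contact t2 x -> contact t3 y -> contact t4 z ->
  (w < x)%N -> (w < z)%N -> (y < x)%N -> (y < z)%N -> False.
Proof.
move=> h1 h2 h3 h4 c1 c2 c3 c4 wx wz yx yz.
have p0 := @pi_gt0 R.
(* When two of the four vertices coincide, the remaining triangle would have both orientations. *)
have [xz|xz] := eqVneq x z.
  rewrite -xz in c4.
  have [wy|wy] := eqVneq w y.
    rewrite -wy in c3.
    have e : q w = q x.
      by apply: (two_contacts h1 h2 h3 h4); [apply: c1.2|apply: c2.2|apply: c3.2|apply: c4.2]; case: c1 c2 => ? _ [].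
    have [u su] := strict c1.1; have := su x c2.1; rewrite gtn_eqF // e ltxx => /(_ isT).
    by [].
  have k1 := contact_ccw h1 h2 (ltac:(lra) : t3 < t1 + 2 * pi) c1 c2 c3.
  have k2 := contact_ccw h3 h4 (ltac:(lra) : t1 + 2 * pi < t3 + 2 * pi) c3 c4 ((contact_turn _ _).1 c1).
  have := k1; have := k2; rewrite (ltn_eqF wx) (gtn_eqF yx) (ltn_eqF yx) (gtn_eqF wx) wy eq_sym wy /cross3.
  by move=> /(_ isT isT isT) ? /(_ isT isT isT) ?; lra.
have [wy|wy] := eqVneq w y.
  rewrite -wy in c3.
  have k1 := contact_ccw h1 (lt_trans h2 h3) h4 c1 c2 c4.
  have k2 := contact_ccw h3 (ltac:(lra) : t4 < t2 + 2 * pi) (ltac:(lra) : t2 + 2 * pi < t3 + 2 * pi) c3 c4 ((contact_turn _ _).1 c2).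
  have := k1; have := k2; rewrite (ltn_eqF wx) (ltn_eqF wz) xz eq_sym xz /cross3.
  by move=> /(_ isT isT isT) ? /(_ isT isT isT) ?; lra.
(* an early edge separating the contact angles of x and z *)
have [i [hi1 hi2 [a [b [ha1 ha2 [hb1 hb2] ci]]]]] : exists i, [/\ (i.+1 < x)%N, (i.+1 < z)%N &
   exists a b, [/\ t2 < a, a < t4, t4 < b /\ b < t2 + 2 * pi &
     (contact a i /\ contact b i.+1) \/ (contact a i.+1 /\ contact b i)]].
  (* Every early vertex gets a contact angle in this window, with [w] beyond [t4] and [y] before it.
     Hence some edge of the path between them jumps over [t4]. *)
  pose P v u := [/\ t2 < u, u < t2 + 2 * pi, u != t4, contact u v & (v = w -> u = t1 + 2 * pi) /\ (v = y -> v != w -> u = t3)].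
  have [f hf] : {f : nat -> R & forall v, (v < x)%N -> (v < z)%N -> P v (f v)}.
    apply: (@choice _ _ (fun v u => (v < x)%N -> (v < z)%N -> P v u)) => v.
    have [vx|vx] := leqP x v; first by exists 0.
    have [vz|vz] := leqP z v; first by exists 0.
    have [->|vw] := eqVneq v w.
      exists (t1 + 2 * pi) => _ _; split; [lra|lra|by rewrite gt_eqF|exact: (contact_turn _ _).1|].
      by split=> //; rewrite eqxx.
    have [ev|vy] := eqVneq v y.
      rewrite ev in vw *.
      exists t3 => _ _; split; [lra|lra|by rewrite lt_eqF|by []|].
      by split=> // e; move: vw; rewrite e eqxx.
    have vN : (v < N)%N := ltn_trans vx c2.1.
    have [|u [u1 u2 u3 u4]] := angle_in c2 vN; first by rewrite ltn_eqF.
    exists u => _ _; split=> //; first by rewrite eq_sym (u4 _ _ c4) // gtn_eqF.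
    by split=> e; [rewrite e eqxx in vw|rewrite e eqxx in vy].
  have cw : (f w < t4) = false.
    by have [_ _ _ _ [-> // _]] := hf w wx wz; apply/negbTE; rewrite -leNgt ltW.
  have cy : (f y < t4) = true.
    by have [_ _ _ _ [_ -> //]] := hf y yx yz; rewrite eq_sym.
  have [k [k1 k2 k3]] : exists k, [/\ (minn w y <= k)%N, (k < maxn w y)%N & (f k < t4) != (f k.+1 < t4)].
    apply: bool_change; first by rewrite geq_min leq_max leqnn.
    by rewrite /minn /maxn; case: ltnP => _; rewrite cw cy.
  have kx : (k.+1 < x)%N by apply: leq_ltn_trans k2 _; rewrite gtn_max wx yx.
  have kz : (k.+1 < z)%N by apply: leq_ltn_trans k2 _; rewrite gtn_max wz yz.
  have [a1 a2 a3 a4 _] := hf k (ltn_trans (ltnSn k) kx) (ltn_trans (ltnSn k) kz).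
  have [b1 b2 b3 b4 _] := hf k.+1 kx kz.
  exists k; split=> //; move: k3; case: (ltP (f k) t4) => d1; case: (ltP (f k.+1) t4) => d2 // _.
    exists (f k), (f k.+1); split=> //; last by left.
    by split=> //; rewrite lt_neqAle eq_sym b3.
  exists (f k.+1), (f k); split=> //; last by right.
  by split=> //; rewrite lt_neqAle eq_sym a3.
have [iN jN] : (i < N)%N /\ (i.+1 < N)%N.
  by case: ci => -[[? _] [? _]].
have [A [B [cA cB AB]]] : exists A B, [/\ contact a A, contact b B &
   (A = i /\ B = i.+1) \/ (A = i.+1 /\ B = i)].
  by case: ci => -[? ?]; [exists i, i.+1|exists i.+1, i]; split=> //; [left|right].
have notlate u : (i.+1 < u)%N -> (A != u) && (B != u).
  by move=> hu; case: AB => -[-> ->]; rewrite !ltn_eqF // (ltn_trans _ hu).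
(* Likewise the path between [x] and [z] has an edge that separates the angles [a] and [b] of the
   early edge. *)
have [j [hj1 hj2 [c [d [hc1 hc2 [hd1 hd2] cj]]]]] : exists j, [/\ (i.+1 < j)%N, (j.+1 < N)%N &
   exists c d, [/\ a < c, c < b, b < d /\ d < a + 2 * pi &
     (contact c j /\ contact d j.+1) \/ (contact c j.+1 /\ contact d j)]].
  pose P v u := [/\ a < u, u < a + 2 * pi, u != b, contact u v & (v = x -> u = t2 + 2 * pi) /\ (v = z -> v != x -> u = t4)].
  have [f hf] : {f : nat -> R & forall v, (i.+1 < v)%N -> (v < N)%N -> P v (f v)}.
    apply: (@choice _ _ (fun v u => (i.+1 < v)%N -> (v < N)%N -> P v u)) => v.
    have [vx|vx] := leqP v i.+1; first by exists 0.
    have [vz|vz] := leqP N v; first by exists 0.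
    have [->|vw] := eqVneq v x.
      exists (t2 + 2 * pi) => _ _; split; [lra|lra|by rewrite gt_eqF|exact: (contact_turn _ _).1|].
      by split=> //; rewrite eqxx.
    have [ev|vy] := eqVneq v z.
      rewrite ev in vw *.
      exists t4 => _ _; split; [lra|lra|by rewrite lt_eqF|by []|].
      by split=> // e; move: vw; rewrite e eqxx.
    have /andP[nA nB] := notlate v vx.
    have [|u [u1 u2 u3 u4]] := angle_in cA vz; first by rewrite eq_sym.
    exists u => _ _; split=> //; first by rewrite eq_sym (u4 _ _ cB).
    by split=> e; [rewrite e eqxx in vw|rewrite e eqxx in vy].
  have cx : (f x < b) = false.
    by have [_ _ _ _ [-> // _]] := hf x hi1 c2.1; apply/negbTE; rewrite -leNgt ltW.
  have cz : (f z < b) = true.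
    by have [_ _ _ _ [_ -> //]] := hf z hi2 c4.1; rewrite eq_sym.
  have [k [k1 k2 k3]] : exists k, [/\ (minn x z <= k)%N, (k < maxn x z)%N & (f k < b) != (f k.+1 < b)].
    apply: bool_change; first by rewrite geq_min leq_max leqnn.
    by rewrite /minn /maxn; case: ltnP => _; rewrite cx cz.
  have ki : (i.+1 < k)%N by apply: leq_trans k1; rewrite leq_min hi1 hi2.
  have kN : (k.+1 < N)%N by apply: leq_ltn_trans k2 _; rewrite gtn_max c2.1 c4.1.
  have [a1 a2 a3 a4 _] := hf k ki (ltn_trans (ltnSn k) kN).
  have [b1 b2 b3 b4 _] := hf k.+1 (ltn_trans ki (ltnSn k)) kN.
  exists k; split=> //; move: k3; case: (ltP (f k) b) => d1; case: (ltP (f k.+1) b) => d2 // _.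
    exists (f k), (f k.+1); split=> //; last by left.
    by split=> //; rewrite lt_neqAle eq_sym b3.
  exists (f k.+1), (f k); split=> //; last by right.
  by split=> //; rewrite lt_neqAle eq_sym a3.
have sw := no_swap (ltn_trans (ltnSn i) hj1) hj2.
have [C [D [cC cD CD]]] : exists C D, [/\ contact c C, contact d D &
   (C = j /\ D = j.+1) \/ (C = j.+1 /\ D = j)].
  by case: cj => -[? ?]; [exists j, j.+1|exists j.+1, j]; split=> //; [left|right].
have un : uniq [:: A; C; B; D].
  have n1 := ltnSn i; have n2 := ltnSn j.
  have n3 := ltn_trans n1 hj1; have n4 := ltn_trans hj1 n2; have n5 := ltn_trans n1 n4.
  by case: AB => -[-> ->]; case: CD => -[-> ->] /=;
    rewrite !inE ?(ltn_eqF n1) ?(ltn_eqF n2) ?(ltn_eqF n3) ?(ltn_eqF n4) ?(ltn_eqF n5) ?(ltn_eqF hj1)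
      ?(gtn_eqF n1) ?(gtn_eqF n2) ?(gtn_eqF n3) ?(gtn_eqF n4) ?(gtn_eqF n5) ?(gtn_eqF hj1).
(* The two edges cross. Depending on how they are directed, [s1] or [s2] contradicts [no_swap]. *)
have s1 := interlaced_shorter hc1 hc2 hd1 hd2 cA cC cB cD un.
have un2 : uniq [:: C; B; D; A].
  by move: un => /=; rewrite !inE !negb_or !andbT; case/and3P=> /and3P[e1 e2 e3] /andP[e4 e5] e6;
    rewrite e4 e5 e6 (eq_sym C A) e1 (eq_sym B A) e2 (eq_sym D A) e3.
have s2 := interlaced_shorter hc2 hd1 hd2 (ltac:(lra) : a + 2 * pi < c + 2 * pi) cC cB cD ((contact_turn _ _).1 cA) un2.
have e1 := dist2C (q i) (q i.+1); have e2 := dist2C (q j) (q j.+1).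
have e3 := dist2C (q i) (q j); have e4 := dist2C (q i) (q j.+1).
have e5 := dist2C (q i.+1) (q j); have e6 := dist2C (q i.+1) (q j.+1).
by case: AB s1 s2 => -[-> ->]; case: CD => -[-> ->] s1 s2; lra.
Qed.

End NoAlternation.

(** * Polygonal paths and reversal of a segment *)

Section PathLength.
Variable R : realType.
Implicit Types (x y : R * R) (s t : seq (R * R)).

Fixpoint polyline_from x s : R :=
  if s is y :: s' then dist2 x y + polyline_from y s' else 0.

Definition polyline s : R := if s is x :: s' then polyline_from x s' else 0.

Lemma dist2_ge0 x y : 0 <= dist2 x y.
Proof. exact: norm2_ge0. Qed.

Lemma dist2_tri x y z : dist2 x z <= dist2 x y + dist2 y z.
Proof. exact: norm2_dist_tri. Qed.

Lemma polyline_from_cat x s t :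
  polyline_from x (s ++ t) = polyline_from x s + polyline_from (last x s) t.
Proof. by elim: s x => [|y s IH] x /=; rewrite ?add0r // IH addrA. Qed.

Lemma polyline_from_rev x s :
  polyline_from (last x s) (rev (belast x s)) = polyline_from x s.
Proof.
elim: s x => [//|y s IH] x /=.
have e : last (last y s) (rev (belast y s)) = y.
  by case: s {IH} => [//|z s] /=; rewrite rev_cons last_rcons.
by rewrite rev_cons -cats1 polyline_from_cat IH e /= addr0 dist2C addrC.
Qed.

Lemma polyline_drop1 s y t : polyline (s ++ t) <= polyline (s ++ y :: t).
Proof.
case: s => [|x s] /=.
  by case: t => //= z t; have := dist2_ge0 y z; lra.
rewrite !polyline_from_cat /=; case: t => [|z t] /=; first by have := dist2_ge0 (last x s) y; lra.
by have := dist2_tri (last x s) y z; lra.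
Qed.

Lemma polyline_fromE x s :
  polyline_from x s = \sum_(k < size s) dist2 (nth 0 (x :: s) k) (nth 0 (x :: s) k.+1).
Proof.
elim: s x => [|y s IH] x; first by rewrite big_ord0.
by rewrite /= big_ord_recl IH.
Qed.

(** Reversing the middle block changes only the two edges at its ends. *)
Lemma polyline_flip x p y q z r :
  polyline ((x :: p) ++ rev (y :: q) ++ z :: r) +
    (dist2 (last x p) y + dist2 (last y q) z) =
  polyline ((x :: p) ++ (y :: q) ++ z :: r) +
    (dist2 (last x p) (last y q) + dist2 y z).
Proof.
have -> : rev (y :: q) = last y q :: rev (belast y q) by rewrite lastI rev_rcons.
rewrite /= !polyline_from_cat /= !polyline_from_cat /= polyline_from_rev.
have -> : last (last y q) (rev (belast y q)) = y.
  by case: q => [//|w q] /=; rewrite rev_cons last_rcons.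
ring.
Qed.

Lemma split_at (s : seq (R * R)) i : (i < size s)%N ->
  exists x p, take i.+1 s = x :: p /\ last x p = nth 0 s i.
Proof.
case: s => [//|x s] /= hi; exists x, (take i s); split=> //.
rewrite (last_nth 0) size_take; rewrite ltnS in hi.
have -> : (if (i < size s)%N then i else size s) = i.
  by case: ltnP => // h; apply/eqP; rewrite eqn_leq h.
by case: i hi => [//|i] hi /=; rewrite nth_take.
Qed.

Lemma flip_segment s i j : (i < j)%N -> (j.+1 < size s)%N ->
  exists t, perm_eq t s /\
  polyline t + (dist2 (nth 0 s i) (nth 0 s i.+1) + dist2 (nth 0 s j) (nth 0 s j.+1)) =
  polyline s + (dist2 (nth 0 s i) (nth 0 s j) + dist2 (nth 0 s i.+1) (nth 0 s j.+1)).
Proof.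
move=> ij js.
have js' := ltnW js; have is_ := ltn_trans ij js'.
have [x [p [Ep lp]]] := split_at is_.
have si : (j - i.+1 < size (drop i.+1 s))%N by rewrite size_drop ltn_sub2r // (leq_ltn_trans ij).
have [y [q [Eq lq]]] := split_at si.
have ey : y = nth 0 s i.+1.
  have : nth 0 (take (j - i.+1).+1 (drop i.+1 s)) 0 = y by rewrite Eq.
  by rewrite nth_take // nth_drop addn0 => <-.
rewrite nth_drop subnKC // in lq.
have Er : drop (j - i.+1).+1 (drop i.+1 s) = nth 0 s j.+1 :: drop j.+2 s.
  by rewrite drop_drop addSn subnK // (drop_nth 0).
have Es : s = (x :: p) ++ (y :: q) ++ nth 0 s j.+1 :: drop j.+2 s.
  by rewrite -Er -Eq -Ep !cat_take_drop.
exists ((x :: p) ++ rev (y :: q) ++ nth 0 s j.+1 :: drop j.+2 s); split.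
  by rewrite {3}Es perm_cat2l perm_cat2r perm_rev.
have := polyline_flip x p y q (nth 0 s j.+1) (drop j.+2 s).
by rewrite -Es lp lq -ey.
Qed.

End PathLength.

(** * Minimal paths with a given hull *)

Section Cover.
Variable R : realType.
Implicit Types (s t : seq (R * R)).

(** Inclusion of convex hulls, expressed by support functions. *)
Definition covers t s : Prop :=
  forall a x, x \in s -> exists2 y, y \in t & dot_dir a x <= dot_dir a y.

(** Only lists of at most [size s] points of [s] compete. Their indices form the finite type [B], on
    which length and then size attain a minimum. *)
Lemma minimal_cover_exists s : exists t, [/\ covers t s, polyline t <= polyline s &
  forall t', {subset t' <= t} -> (size t' <= size t)%N -> covers t' s ->
    polyline t <= polyline t' /\ (polyline t' <= polyline t -> (size t <= size t')%N)].
Proof.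
pose n := size s; pose B := n.-bseq 'I_n.
pose f (b : B) := [seq nth 0 s (i : 'I_n) | i <- b].
pose P (b : B) := `[< covers (f b) s >].
have lift t : {subset t <= s} -> (size t <= n)%N -> exists b : B, f b = t.
  move=> ts tn.
  have sz : (size (pmap insub [seq index x s | x <- t] : seq 'I_n) <= n)%N.
    by apply: leq_trans tn; rewrite size_pmap (leq_trans (count_size _ _)) // size_map.
  exists (Bseq sz); rewrite /f /=.
  elim: t ts {tn sz} => [//|x t IH] ts /=.
  have xs : x \in s by apply: ts; rewrite inE eqxx.
  have xi : (index x s < n)%N by rewrite index_mem.
  rewrite insubT /= nth_index //; congr (_ :: _); apply: IH => z zt.
  by apply: ts; rewrite inE zt orbT.
have [b0 eb0] := lift s (fun _ => id) (leqnn n).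
have Pb0 : P b0 by apply/asboolP; rewrite eb0 => a x xs; exists x.
case: (@arg_minP _ _ _ b0 P (fun b => polyline (f b)) Pb0) => b1 Pb1 m1.
pose P2 b := P b && (polyline (f b) <= polyline (f b1)).
have Pb12 : P2 b1 by rewrite /P2 Pb1 lexx.
case: (@arg_minnP _ b1 P2 (fun b => size (f b)) Pb12) => b /andP[Pb lb] m2.
exists (f b); split.
- exact/asboolP.
- by rewrite -eb0; apply: le_trans lb _; exact: m1.
move=> t' sub sz cov.
have fs : {subset f b <= s}.
  by move=> _ /mapP[i _ ->]; apply: mem_nth.
have szb : (size (f b) <= n)%N by rewrite size_map size_bseq.
have [b' eb'] := lift t' (fun x h => fs x (sub x h)) (leq_trans sz szb).
have Pb' : P b' by apply/asboolP; rewrite eb'.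
have m1' := m1 b' Pb'; rewrite eb' in m1'; split; first exact: le_trans lb m1'.
move=> l; rewrite -eb'; apply: m2; rewrite /P2 Pb' eb' /=.
exact: le_trans l lb.
Qed.

Lemma minimal_cover s : exists t, [/\ covers t s, polyline t <= polyline s,
  (forall i, (i < size t)%N -> exists a, forall j, (j < size t)%N -> j != i ->
     dot_dir a (nth 0 t j) < dot_dir a (nth 0 t i)) &
  forall i j, (i < j)%N -> (j.+1 < size t)%N ->
    dist2 (nth 0 t i) (nth 0 t i.+1) + dist2 (nth 0 t j) (nth 0 t j.+1) <=
    dist2 (nth 0 t i) (nth 0 t j) + dist2 (nth 0 t i.+1) (nth 0 t j.+1)].
Proof.
have [t [cov len m]] := minimal_cover_exists s; exists t; split=> //.
  move=> i it; pose t' := take i t ++ drop i.+1 t.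
  have Et : t = take i t ++ nth 0 t i :: drop i.+1 t by rewrite -drop_nth // cat_take_drop.
  have sub : {subset t' <= t}.
    by move=> x; rewrite /t' {3}Et !mem_cat inE => /orP[] ->; rewrite ?orbT.
  have sz : (size t' < size t)%N by rewrite /t' {3}Et !size_cat /= addnS.
  (* Dropping a vertex shortens the list without lengthening the path, so it must lose part of the
     hull; a direction showing this has the dropped vertex as its only maximum. *)
  have ncov : ~ covers t' s.
    move=> cov'; have [_ /(_ _)] := m t' sub (ltnW sz) cov'.
    by rewrite leqNgt sz => H; apply: notF; apply: H; rewrite /t' {3}Et polyline_drop1.
  have [a /existsNP[x /not_implyP[xs h]]] : exists a, ~ (forall x, x \in s ->
      exists2 y, y \in t' & dot_dir a x <= dot_dir a y) by exact/existsNP.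
  exists a => j jt ji.
  have below y : y \in t' -> dot_dir a y < dot_dir a x.
    by move=> yt; rewrite ltNge; apply/negP => k; apply: h; exists y.
  have [y yt xy] := cov a x xs.
  have yi : y = nth 0 t i.
    have : (y == nth 0 t i) || (y \in t').
      by rewrite /t' mem_cat orbCA -in_cons -mem_cat -Et.
    by move=> /orP[/eqP //|/below]; rewrite ltNge xy.
  rewrite -yi; apply: lt_le_trans xy; apply: below; rewrite mem_cat.
  have [k|k] := ltnP j i.
    by rewrite -(@nth_take i _ 0 j k) mem_nth // size_take it.
  have ij : (i < j)%N by rewrite ltn_neqAle eq_sym ji.
  by rewrite -(subnKC ij) -nth_drop mem_nth ?orbT // size_drop ltn_sub2r // (leq_ltn_trans ij).
move=> i j ij jt; have [t' [pe e]] := flip_segment ij jt.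
have [l _] : polyline t <= polyline t' /\ (polyline t' <= polyline t -> (size t <= size t')%N).
  apply: m; first by move=> x; rewrite (perm_mem pe).
    by rewrite (perm_size pe).
  by move=> a x /(cov a)[y yt xy]; exists y => //; rewrite (perm_mem pe).
lra.
Qed.

End Cover.

(** * Values at 30 degrees, and distances as directional differences *)

Section Trig.
Variable R : realType.
Local Notation pi := (@pi R).

(** Taken from the cosine, so that the trigonometric values are immediate; its square follows from
    expanding cos (pi / 2) as the cosine of three times pi / 6. *)
Definition sqrt3 : R := 2 * cos (pi / 6).

Lemma cos_pi6_gt0 : 0 < cos (pi / 6).
Proof. by apply: cos_gt0_pihalf; have := @pi_gt0 R => ?; apply/andP; split; lra. Qed.

Lemma sqrt3_gt0 : 0 < sqrt3.
Proof. by rewrite mulr_gt0 ?cos_pi6_gt0. Qed.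

Lemma sqrt3_sq : sqrt3 ^+ 2 = 3.
Proof.
have := cos_pihalf R; have -> : pi / 2 = pi / 6 + (pi / 6 + pi / 6) by field.
rewrite !cosD !sinD /sqrt3 => h; have s := cos2Dsin2 (pi / 6); have c0 := cos_pi6_gt0.
set c := cos _ in h s c0 *; set z := sin _ in h s.
have z2 : z ^+ 2 = 1 - c ^+ 2 by lra.
have : c * (4 * c ^+ 2 - 3) = 0 by rewrite -[RHS]h; ring: z2.
move/eqP; rewrite mulf_eq0 (gt_eqF c0) /= => /eqP; lra.
Qed.

Lemma sin_pi6 : sin (pi / 6) = 1 / 2.
Proof.
have p0 := @pi_gt0 R.
have s0 : 0 < sin (pi / 6) by apply: sin_gt0_pi; apply/andP; split; lra.
have := cos2Dsin2 (pi / 6); have := sqrt3_sq; rewrite /sqrt3 => h1 h2.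
have : (sin (pi / 6) - 1 / 2) * (sin (pi / 6) + 1 / 2) = 0 by lra.
move/eqP; rewrite mulf_eq0 => /orP[/eqP|/eqP]; lra.
Qed.

Lemma cos_2pi3 : cos (2 * pi / 3) = - (1 / 2).
Proof.
have -> : 2 * pi / 3 = pi / 6 + pi / 2 by field.
by rewrite cosDpihalf sin_pi6.
Qed.

Lemma sin_2pi3 : sin (2 * pi / 3) = sqrt3 / 2.
Proof.
have -> : 2 * pi / 3 = pi / 6 + pi / 2 by field.
by rewrite sinDpihalf /sqrt3; field.
Qed.

Lemma polar_angle (x y : R) : x ^+ 2 + y ^+ 2 = 1 -> exists t, cos t = x /\ sin t = y.
Proof.
move=> h.
have x1 : -1 <= x <= 1 by apply/andP; split; nra.
have ca : cos (acos x) = x by apply: acosK; rewrite in_itv.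
have e : Num.sqrt (1 - x ^+ 2) = `|y| by rewrite -sqrtr_sqr; congr Num.sqrt; lra.
have sa : sin (acos x) = `|y| by rewrite sin_acos.
have [y0|y0] := lerP 0 y.
  by exists (acos x); rewrite ca sa ger0_norm.
by exists (- acos x); rewrite cosN sinN ca sa ltr0_norm // opprK.
Qed.

Lemma dot_dir_le (t : R) (v w : R * R) : dot_dir t v - dot_dir t w <= dist2 v w.
Proof.
rewrite -dot_dirB /dot_dir /dist2 /= mulrC [_ * sin t]mulrC.
by apply: norm2_dir; rewrite cos2Dsin2.
Qed.

(** With [dot_dir_le], a distance is a maximum of directional differences, so distance bounds pass
    from a covering list to the covered points. *)
Lemma dot_dir_attained (v w : R * R) : exists t, dot_dir t v - dot_dir t w = dist2 v w.
Proof.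
have [e|n0] := eqVneq (dist2 v w) 0.
  exists 0; apply/eqP; rewrite eq_le dot_dir_le e -dot_dirB /dot_dir /= cos0 sin0.
  have h := norm2_sq (v.1 - w.1) (v.2 - w.2); rewrite -/(dist2 v w) e in h.
  by have := sqr_ge0 (v.1 - w.1); have := sqr_ge0 (v.2 - w.2); nra.
have h := norm2_sq (v.1 - w.1) (v.2 - w.2); rewrite -/(dist2 v w) in h.
set d := dist2 v w in n0 h *.
have [t [ct st]] : exists t, cos t = (v.1 - w.1) / d /\ sin t = (v.2 - w.2) / d.
  by apply: polar_angle; rewrite !expr_div_n -mulrDl -h divff // expf_eq0.
exists t; rewrite -dot_dirB /dot_dir /= ct st !mulrA -mulrDl -!expr2 -h expr2 -mulrA divff //.
by rewrite mulr1.
Qed.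

Lemma dot_dir_turns (t : R) (m : int) (v : R * R) : dot_dir (t + 2 * pi * m%:~R) v = dot_dir t v.
Proof.
apply: (@supp_turns _ pi unit (fun u _ => dot_dir u v = dot_dir t v) t tt m) => //.
by move=> u _; rewrite dot_dir_turn.
Qed.

End Trig.

(** * Coordinates in the frame of a wedge *)

Section Frame.
Variables (R : realType) (I : finType) (p : I -> R * R).
Local Notation pi := (@pi R).
Local Notation n2 := (@norm2 R).

Definition frame_x (mu : R) (P v : R * R) : R := dot_dir mu v - dot_dir mu P.
Definition frame_y (k mu : R) (P v : R * R) : R :=
  k * (dot_dir (mu + pi / 2) v - dot_dir (mu + pi / 2) P).

Lemma frame_norm k mu P v w : k = 1 \/ k = -1 ->
  n2 (frame_x mu P v - frame_x mu P w) (frame_y k mu P v - frame_y k mu P w) = dist2 v w.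
Proof.
move=> hk; apply: norm2_eq; rewrite /frame_x /frame_y /dot_dir cosDpihalf sinDpihalf.
have h := cos2Dsin2 mu.
transitivity (((v.1 - w.1) ^+ 2 + (v.2 - w.2) ^+ 2) * (cos mu ^+ 2 + sin mu ^+ 2)).
  by case: hk => ->; ring.
by rewrite h mulr1.
Qed.

Lemma frame_norm0 k mu P v : k = 1 \/ k = -1 ->
  n2 (frame_x mu P v) (frame_y k mu P v) = dist2 v P.
Proof.
move=> hk; rewrite -(frame_norm mu P v P hk).
by congr norm2; rewrite /frame_x /frame_y; ring.
Qed.

Lemma side_normal k mu v : k = 1 \/ k = -1 ->
  dot_dir (mu - k * (pi / 2)) v = - (k * dot_dir (mu + pi / 2) v).
Proof.
move=> [->|->]; rewrite /dot_dir ?mul1r ?mulN1r ?opprK cosDpihalf sinDpihalf //.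
by rewrite cosBpihalf sinBpihalf; ring.
Qed.

Lemma far_normal k mu v : k = 1 \/ k = -1 ->
  dot_dir (mu + k * (2 * pi / 3)) v =
  - (1 / 2) * dot_dir mu v + sqrt3 R / 2 * (k * dot_dir (mu + pi / 2) v).
Proof.
move=> [->|->]; rewrite dot_dirD ?mul1r ?mulN1r ?cosN ?sinN cos_2pi3 sin_2pi3 //; ring.
Qed.

Lemma near_triple_frame (W : I -> R) k mu A B A' : k = 1 \/ k = -1 ->
  near_triple pi (supports p) W k mu A B A' ->
  supports p (mu - k * (pi / 2)) A -> supports p (mu - k * (pi / 2)) A' ->
  supports p (mu + k * (2 * pi / 3)) B ->
  (forall i j, W i <= W j -> dist2 (p j) (p i) <= W j - W i) ->
  exists P, wedge_triple (sqrt3 R) (fun i => frame_x mu P (p i))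
    (fun i => frame_y k mu P (p i)) W A B A'.
Proof.
move=> hk [hA hA' _ AB BA'] sA sA' sB dW.
pose r3 := sqrt3 R.
pose yB := k * (dot_dir (mu + pi / 2) (p B) - dot_dir (mu + pi / 2) (p A)).
(* [a] is the abscissa of A counted from the apex P, fixed by requiring B to lie on the second
   side. *)
pose a := r3 * yB - (dot_dir mu (p B) - dot_dir mu (p A)).
pose P : R * R := ((p A).1 - a * cos mu, (p A).2 - a * sin mu).
have e1 : dot_dir mu P = dot_dir mu (p A) - a.
  rewrite /dot_dir /P /=; transitivity ((p A).1 * cos mu + (p A).2 * sin mu - a * (cos mu ^+ 2 + sin mu ^+ 2)); first by ring.
  by rewrite cos2Dsin2 mulr1.
have e2 : dot_dir (mu + pi / 2) P = dot_dir (mu + pi / 2) (p A).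
  by rewrite /dot_dir /P /= cosDpihalf sinDpihalf; ring.
have yA' : k * dot_dir (mu + pi / 2) (p A') = k * dot_dir (mu + pi / 2) (p A).
  have := sA A'; have := sA' A; rewrite !side_normal // !lerN2 => h1 h2.
  by apply/eqP; rewrite eq_le h1 h2.
exists P; split=> //.
- by move=> i j /dW; rewrite frame_norm.
- by move=> i; rewrite /frame_y e2; have := sA i; rewrite !side_normal // lerN2 mulrBr subr_ge0.
- move=> i; rewrite /frame_x /frame_y e1 e2; have := sB i; rewrite !far_normal // /a /yB /r3.
  lra.
- by rewrite /frame_y e2 subrr mulr0.
- by rewrite /frame_y e2 mulrBr yA' subrr.
- by rewrite /frame_x /frame_y e1 e2 /a -/yB /r3; ring.
(* A is still extreme when the normal is turned slightly by [- k], so A' cannot be nearer to the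
   apex. *)
- rewrite /frame_x lerD2r; case: hA => e e0 he.
  have p0 := @pi_gt0 R.
  have [s s0 /and3P[s1 s2 _]] := @small_lt R [:: e; pi] ltac:(by rewrite /= e0 p0).
  have := he s ltac:(by rewrite s0) A'; rewrite !(dot_dirD _ (- k * s)).
  have z0 : 0 < sin s by apply: sin_gt0_pi; rewrite s0.
  have -> : dot_dir (mu - k * (pi / 2)) (p A') = dot_dir (mu - k * (pi / 2)) (p A).
    by rewrite !side_normal // yA'.
  rewrite lerD2l => h; rewrite -(ler_pM2l z0); move: h.
  case: hk => ->; rewrite ?mulN1r ?opprK ?mul1r ?sinN ?subrK //; first by rewrite !mulNr lerN2.
  have -> : mu + pi / 2 + pi / 2 = mu + pi by field.
  have half v : dot_dir (mu + pi) v = - dot_dir mu v.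
    by rewrite /dot_dir (cosDpi mu) (sinDpi mu); ring.
  by rewrite !half !mulrN lerN2.
Qed.

Lemma frame_turned k mu1 mu2 P1 P2 : k = 1 \/ k = -1 ->
  5 * pi / 6 <= mu2 - mu1 <= 7 * pi / 6 ->
  turned (sqrt3 R) (fun i => frame_x mu1 P1 (p i)) (fun i => frame_y k mu1 P1 (p i))
    (fun i => frame_x mu2 P2 (p i)) (fun i => frame_y k mu2 P2 (p i)).
Proof.
move=> hk /andP[h1 h2]; have p0 := @pi_gt0 R.
pose ps := mu2 - mu1.
have E v : dot_dir mu1 v = cos ps * dot_dir mu2 v - sin ps * dot_dir (mu2 + pi / 2) v.
  have -> : mu1 = mu2 + - ps by rewrite /ps; ring.
  by rewrite dot_dirD cosN sinN; ring.
have E' v : dot_dir (mu1 + pi / 2) v = cos ps * dot_dir (mu2 + pi / 2) v + sin ps * dot_dir mu2 v.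
  have -> : mu1 + pi / 2 = mu2 + pi / 2 + - ps by rewrite /ps; ring.
  rewrite dot_dirD cosN sinN.
  have -> : mu2 + pi / 2 + pi / 2 = mu2 + pi by field.
  have -> : dot_dir (mu2 + pi) v = - dot_dir mu2 v.
    by rewrite /dot_dir (cosDpi mu2) (sinDpi mu2); ring.
  ring.
exists (cos ps * dot_dir mu2 P2 - sin ps * dot_dir (mu2 + pi / 2) P2 - dot_dir mu1 P1).
exists (k * (cos ps * dot_dir (mu2 + pi / 2) P2 + sin ps * dot_dir mu2 P2 - dot_dir (mu1 + pi / 2) P1)).
exists (- cos ps), (- (k * sin ps)).
have k2 : k ^+ 2 = 1 by case: hk => ->; ring.
split.
- have := cos2Dsin2 ps; rewrite !sqrrN exprMn k2 mul1r; lra.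
- rewrite /sqrt3 mulrC mulKf ?pnatr_eq0 //.
  (* The relative turn differs from pi by at most pi / 6. *)
  have -> : - cos ps = cos `|ps - pi|.
    by rewrite cos_norm (cosB ps) cospi sinpi; ring.
  rewrite leNgt ltr_cos -?leNgt.
  + by rewrite ler_norml /ps; apply/andP; split; lra.
  + by rewrite in_itv /=; apply/andP; split; lra.
  + by rewrite in_itv /= normr_ge0 ler_norml /ps; apply/andP; split; lra.
- move=> i; rewrite /frame_x /frame_y (E (p i)) (E' (p i)); split.
    ring: k2.
  ring: k2.
Qed.

Lemma frame_mirrored k1 k2 mu1 P1 P2 A : k1 = 1 \/ k1 = -1 -> k1 = - k2 ->
  frame_y k1 mu1 P1 (p A) = 0 -> frame_y k2 (mu1 + pi) P2 (p A) = 0 ->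
  mirrored (fun i => frame_x mu1 P1 (p i)) (fun i => frame_y k1 mu1 P1 (p i))
    (fun i => frame_x (mu1 + pi) P2 (p i)) (fun i => frame_y k2 (mu1 + pi) P2 (p i)).
Proof.
have half t v : dot_dir (t + pi) v = - dot_dir t v.
  by rewrite /dot_dir (cosDpi t) (sinDpi t); ring.
move=> hk ek; have -> : k2 = - k1 by rewrite ek opprK.
have e : mu1 + pi + pi / 2 = mu1 + pi / 2 + pi by ring.
rewrite /frame_x /frame_y e => h1; rewrite !half => h2.
exists (dot_dir mu1 P2 - dot_dir mu1 P1) => i.
rewrite !half; split; first by ring.
by move: h1 h2; rewrite !mulrBr; lra.
Qed.

End Frame.

(** * A sector for a polygonal path *)

Section Fit.
Variable R : realType.
Local Notation pi := (@pi R).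

(** The first two conditions cut out the wedge at [P] of polar angles from [mu] to [mu + pi / 6], by
    its outer normals. *)
Definition in_sector (P : R * R) (mu L : R) (v : R * R) : Prop :=
  [/\ dot_dir (mu - pi / 2) v <= dot_dir (mu - pi / 2) P,
      dot_dir (mu + 2 * pi / 3) v <= dot_dir (mu + 2 * pi / 3) P &
      dist2 v P <= L].

Section Path.
Variables (n : nat) (t : seq (R * R)).
Hypothesis size_t : size t = n.+1.
Hypothesis strict : forall i, (i < size t)%N -> exists a, forall j, (j < size t)%N -> j != i ->
     dot_dir a (nth 0 t j) < dot_dir a (nth 0 t i).
Hypothesis no_swap : forall i j, (i < j)%N -> (j.+1 < size t)%N ->
    dist2 (nth 0 t i) (nth 0 t i.+1) + dist2 (nth 0 t j) (nth 0 t j.+1) <=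
    dist2 (nth 0 t i) (nth 0 t j) + dist2 (nth 0 t i.+1) (nth 0 t j.+1).

Let p (i : 'I_n.+1) : R * R := nth 0 t i.
(** The time of a vertex is the length of the path up to it. *)
Let Wn (i : nat) : R := \sum_(k < i) dist2 (nth 0 t k) (nth 0 t k.+1).
Let W (i : 'I_n.+1) : R := Wn i.
Let V (i : 'I_n.+1) : R := - W i.

Lemma Wn_S i : Wn i.+1 = Wn i + dist2 (nth 0 t i) (nth 0 t i.+1).
Proof. by rewrite /Wn big_ord_recr. Qed.

Lemma Wn_dist i j : (i <= j)%N -> dist2 (nth 0 t i) (nth 0 t j) <= Wn j - Wn i.
Proof.
move=> /subnKC <-; elim: (j - i)%N => [|d IH].
  by rewrite addn0 /dist2 !subrr /norm2 expr0n /= addr0 sqrtr0.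
rewrite addnS Wn_S; have := dist2_tri (nth 0 t i) (nth 0 t (i + d)) (nth 0 t (i + d).+1); lra.
Qed.

Lemma Wn_mono i j : (i <= j)%N -> Wn i <= Wn j.
Proof. by move=> ij; have := Wn_dist ij; have := dist2_ge0 (nth 0 t i) (nth 0 t j); lra. Qed.

Lemma p_inj : injective p.
Proof.
move=> i j e; apply/val_inj/eqP; apply: contraT => ij.
have [a h] := strict (ltac:(by rewrite size_t) : (j < size t)%N).
by have := h i ltac:(by rewrite size_t) ij; rewrite -/(p i) -/(p j) e ltxx.
Qed.

Lemma W_lt i j : W i < W j -> (i < j)%N.
Proof. by move=> h; rewrite ltnNge; apply/negP => /Wn_mono; rewrite -/(W i) -/(W j); lra. Qed.

Lemma lt_W (i j : 'I_n.+1) : (i < j)%N -> W i < W j.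
Proof.
move=> ij; apply: lt_le_trans (Wn_mono ij); rewrite Wn_S ltrDl.
rewrite lt_neqAle dist2_ge0 andbT eq_sym; apply/eqP => e.
have i1 : (i.+1 < n.+1)%N by apply: leq_ltn_trans ij _.
have h := norm2_sq ((nth 0 t i).1 - (nth 0 t i.+1).1) ((nth 0 t i).2 - (nth 0 t i.+1).2).
rewrite -/(dist2 _ _) e expr0n /= in h.
have h1 := sqr_ge0 ((nth 0 t i).1 - (nth 0 t i.+1).1).
have h2 := sqr_ge0 ((nth 0 t i).2 - (nth 0 t i.+1).2).
have /eqP : ((nth 0 t i).1 - (nth 0 t i.+1).1) ^+ 2 = 0 by lra.
have /eqP : ((nth 0 t i).2 - (nth 0 t i.+1).2) ^+ 2 = 0 by lra.
rewrite !sqrf_eq0 !subr_eq0 => /eqP e2 /eqP e1.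
have : p i = p (Ordinal i1).
  by rewrite /p /=; case: (nth 0 t i) (nth 0 t i.+1) e1 e2 => [? ?] [? ?] /= -> ->.
by move=> /p_inj /(congr1 val) /= /eqP; rewrite ltn_eqF.
Qed.

Lemma W_injective : injective W.
Proof.
move=> i j e; apply/val_inj; case: (ltngtP i j) => // /lt_W; by rewrite e ltxx.
Qed.

Lemma supports_contact a i : supports p a i <-> contact (size t) (fun k => nth 0 t k) a i.
Proof.
split=> [h|[_ h] j]; last by apply: h; rewrite size_t.
split=> [|j]; first by rewrite size_t.
by rewrite size_t => hj; exact: (h (Ordinal hj)).
Qed.

Lemma W_no_alternation : no_alternation pi (supports p) W.
Proof.
move=> t1 t2 t3 t4 w x y z h1 h2 h3 h4 /supports_contact c1 /supports_contact c2.
move=> /supports_contact c3 /supports_contact c4 /W_lt k1 /W_lt k2 /W_lt k3 /W_lt k4.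
exact: (contacts_no_alternation strict no_swap h1 h2 h3 h4 c1 c2 c3 c4).
Qed.

(** Reversing time exchanges lower and higher vertices, so the cyclic sequence is read from its
    second element. *)
Lemma V_no_alternation : no_alternation pi (supports p) V.
Proof.
move=> t1 t2 t3 t4 w x y z h1 h2 h3 h4 c1 c2 c3 c4; rewrite /V !ltrN2 => k1 k2 k3 k4.
apply: (W_no_alternation h2 h3 h4 (_ : t1 + 2 * pi < t2 + 2 * pi) c2 c3 c4 ((supports_periodic p _ _).1 c1)) => //.
by rewrite ltrD2r.
Qed.

Lemma W_dist i j : W i <= W j -> dist2 (p j) (p i) <= W j - W i.
Proof.
have [ij|ij] := leqP i j; first by move=> _; rewrite dist2C; exact: Wn_dist.
by move=> h; have := lt_W ij; lra.
Qed.

Lemma V_dist i j : V i <= V j -> dist2 (p j) (p i) <= V j - V i.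
Proof. by rewrite /V lerN2 => /W_dist; rewrite dist2C; lra. Qed.

Lemma W_bound i j : W j - W i <= polyline t.
Proof.
have -> : polyline t = Wn n.
  rewrite /Wn /polyline; case: t size_t => [//|x s] /= [<-].
  exact: polyline_fromE.
have h1 : W j <= Wn n by apply: Wn_mono; rewrite -ltnS.
have h2 : Wn 0 <= W i by apply: Wn_mono.
have e : Wn 0 = 0 by rewrite /Wn big_ord0.
lra.
Qed.

Lemma apex_fits a i : supports p a i -> supports p (a + 5 * pi / 6) i ->
  exists P mu, forall j, in_sector P mu (polyline t) (p j).
Proof.
move=> h1 h2; exists (p i), (a - 2 * pi / 3) => j; split.
- have e : a + 5 * pi / 6 = a - 2 * pi / 3 - pi / 2 + 2 * pi by field.
  by have := h2 j; rewrite e !dot_dir_turn.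
- by rewrite subrK; exact: h1.
have [h|h] := lerP (W i) (W j).
  exact: le_trans (W_dist h) (W_bound _ _).
by rewrite dist2C; exact: le_trans (W_dist (ltW h)) (W_bound _ _).
Qed.

Lemma frame_fits U k mu P A B A' : k = 1 \/ k = -1 ->
  wedge_triple (sqrt3 R) (fun i => frame_x mu P (p i)) (fun i => frame_y k mu P (p i)) U A B A' ->
  (forall i, norm2 (frame_x mu P (p i)) (frame_y k mu P (p i)) <= polyline t) ->
  exists P mu, forall j, in_sector P mu (polyline t) (p j).
Proof.
move=> hk T hd.
have side j : dot_dir (mu - k * (pi / 2)) (p j) <= dot_dir (mu - k * (pi / 2)) P.
  by rewrite !side_normal // lerN2 -subr_ge0 -mulrBr; exact: (wt_ge0 T j).
have far j : dot_dir (mu + k * (2 * pi / 3)) (p j) <= dot_dir (mu + k * (2 * pi / 3)) P.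
  rewrite !far_normal //; have := wt_le T j; rewrite /frame_x /frame_y; lra.
have dist j : dist2 (p j) P <= polyline t by rewrite -(frame_norm0 mu P (p j) hk).
exists P; case: hk side far => -> side far.
  exists mu => j; split=> //; first by have := side j; rewrite mul1r.
  by have := far j; rewrite mul1r.
(* A wedge of orientation -1 spans the angles from mu - pi / 6 to [mu]. *)
exists (mu - pi / 6) => j; split=> //.
  have -> : mu - pi / 6 - pi / 2 = mu + -1 * (2 * pi / 3) by field.
  exact: far.
have -> : mu - pi / 6 + 2 * pi / 3 = mu - -1 * (pi / 2) by field.
exact: side.
Qed.

Lemma optimal_path_fits : exists P mu, forall j, in_sector P mu (polyline t) (p j).
Proof.
have loc := local_contact p_inj ord0.
have per := supports_periodic p.
have V_injective : injective V by move=> i j /oppr_inj/W_injective.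
have [[a [i [h1 h2]]]|[k1 [mu1 [A [B [A' [hk1 N1 a1 a1' b1]]]]]]] := near_triple_exists per W_injective loc.
  exact: apex_fits h1 h2.
(* The second wedge comes from the reversed path, timed by [V]. *)
have [[a [i [h1 h2]]]|[k2 [mu2 [C' [D [C [hk2 N2 c2 c2' d2]]]]]]] := near_triple_exists per V_injective loc.
  exact: apex_fits h1 h2.
have VW i : V i = - W i by [].
have out := order_facts (@pi_gt0 R) per W_no_alternation V_no_alternation (supports_sharp p_inj) VW hk1 hk2 N1 N2.
have [m hm] : exists m : int, order_outcome pi W A B A' C D C' k1 k2 mu1 mu2 ->
  [\/ W A' <= W C, W C' <= W A,
     [/\ k1 = k2, W B <= W C, W A' <= W D & 5 * pi / 6 <= (mu2 + 2 * pi * m%:~R) - mu1 <= 7 * pi / 6] |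
     [/\ k1 = - k2, A = C, A' = C' & W B <= W D /\ mu2 + 2 * pi * m%:~R = mu1 + pi]].
  case: out => [h|h|m h1 h2 h3 h4|m h1 h2 h3 h4 h5].
  - by exists 0 => _; constructor 1.
  - by exists 0 => _; constructor 2.
  - by exists m => _; constructor 3; split=> //; rewrite addrAC.
  - by exists m => _; constructor 4; split=> //; split=> //; lra.
have [P1 T1] := near_triple_frame hk1 N1 a1 a1' b1 W_dist.
set mu2' := mu2 + 2 * pi * m%:~R in hm.
have shift r v : dot_dir (mu2' + r) v = dot_dir (mu2 + r) v.
  by rewrite /mu2' addrAC dot_dir_turns.
have N2' : near_triple pi (supports p) V k2 mu2' C' D C := near_triple_turns m per N2.
have [P2 T2] : exists P, wedge_triple (sqrt3 R) (fun i => frame_x mu2' P (p i))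
    (fun i => frame_y k2 mu2' P (p i)) V C' D C.
  by apply: near_triple_frame V_dist => // j; rewrite !shift; [exact: c2|exact: c2'|exact: d2].
have iso i j : norm2 (frame_x mu1 P1 (p j) - frame_x mu1 P1 (p i)) (frame_y k1 mu1 P1 (p j) - frame_y k1 mu1 P1 (p i))
  = norm2 (frame_x mu2' P2 (p j) - frame_x mu2' P2 (p i)) (frame_y k2 mu2' P2 (p j) - frame_y k2 mu2' P2 (p i)).
  by rewrite !frame_norm.
have O : order_cases (sqrt3 R) (fun i => frame_x mu1 P1 (p i)) (fun i => frame_y k1 mu1 P1 (p i))
  (fun i => frame_x mu2' P2 (p i)) (fun i => frame_y k2 mu2' P2 (p i)) W A B A' C D C'.
  case: (hm out) => [h|h|[e h1 h2 h3]|[e h1 h2 [h3 h4]]].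
  - exact: Disjoint.
  - exact: Disjoint'.
  - by apply: Zigzag => //; rewrite -e; exact: frame_turned.
  apply: SameSide => //; have := wt_A T1; have := wt_A' T2; rewrite -h1 h4.
  by move=> z2 z1; exact: frame_mirrored z1 z2.
have [h|h] := two_wedges (sqrt3_gt0 R) (sqrt3_sq R) VW T1 T2 W_bound iso O.
  exact: frame_fits T1 h.
exact: frame_fits T2 h.
Qed.

End Path.

Lemma finite_fits (s : seq (R * R)) : exists P mu, forall v, v \in s -> in_sector P mu (polyline s) v.
Proof.
have [t [cov len st ns]] := minimal_cover s.
have [P [mu h]] : exists P mu, forall v, v \in t -> in_sector P mu (polyline t) v.
  case E : (size t) => [|n].
    by move/size0nil: E => ->; exists 0, 0.
  have [P [mu h]] := optimal_path_fits E st ns; exists P, mu => v vt.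
  have hi : (index v t < n.+1)%N by rewrite -E index_mem.
  by have := h (Ordinal hi); rewrite /= nth_index.
exists P, mu => v vs; split.
- by have [y yt l] := cov (mu - pi / 2) v vs; apply: (le_trans l); have [] := h y yt.
- by have [y yt l] := cov (mu + 2 * pi / 3) v vs; apply: (le_trans l); have [] := h y yt.
(* In the direction realising the distance from [v] to [P], some vertex of [t] is at least as
   far. *)
have [a <-] := dot_dir_attained v P; have [y yt l] := cov a v vs.
have [_ _ d] := h y yt; have := dot_dir_le a y P; lra.
Qed.

End Fit.

Local Open Scope classical_set_scope.
Local Open Scope ring_scope.

(** * From polygonal paths to arcs *)

Section Placement.
Variable R : realType.

Lemma in_sector_polar (P v : R * R) mu : in_sector P mu 1 v ->
  exists rho t : R, [/\ 0 <= rho <= 1, 0 <= t <= pi / 6,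
    dot_dir mu v - dot_dir mu P = rho * cos t &
    dot_dir (mu + pi / 2) v - dot_dir (mu + pi / 2) P = rho * sin t].
Proof.
move=> [h1 h2 h3]; have p0 := @pi_gt0 R.
set u := dot_dir mu v - _; set w := _ - dot_dir (mu + pi / 2) P.
have s1 : 0 <= w.
  have := @side_normal R 1 mu; rewrite mul1r => S.
  by rewrite !S ?mul1r in h1; [rewrite /w; lra|left|left].
have s2 : sqrt3 R * w <= u.
  have := @far_normal R 1 mu; rewrite mul1r => S.
  by rewrite !S ?mul1r in h2; [rewrite /u /w; lra|left|left].
have r0 := sqrt3_gt0 R; have r2 := sqrt3_sq R.
have rw : 0 <= sqrt3 R * w by apply: mulr_ge0 => //; exact: ltW.
have hd : dist2 v P ^+ 2 = u ^+ 2 + w ^+ 2.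
  rewrite -(@frame_norm0 R 1 mu) ?norm2_sq /frame_x /frame_y ?mul1r //; by left.
have d0 := dist2_ge0 v P.
have uw : 3 * w ^+ 2 <= u ^+ 2.
  rewrite -r2 -exprMn ler_sqr ?nnegrE //; lra.
(* At the apex the polar angle is arbitrary; 0 is taken. *)
have [d|dn] := eqVneq (dist2 v P) 0.
  exists 0, 0; rewrite !mul0r lexx ler01; split=> //.
  - by rewrite ?lexx /= divr_ge0 // ltW.
  - by rewrite d expr0n /= in hd; apply/eqP; rewrite -sqrf_eq0; apply/eqP; have := sqr_ge0 w; nra.
  - by rewrite d expr0n /= in hd; apply/eqP; rewrite -sqrf_eq0; apply/eqP; have := sqr_ge0 u; nra.
have dp : 0 < dist2 v P by rewrite lt_neqAle eq_sym dn.
set d := dist2 v P in h3 hd d0 dn dp.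
have u0 : 0 <= u by lra.
have ud : u / d <= 1.
  by rewrite ler_pdivrMr // mul1r -ler_sqr ?nnegrE // hd lerDl sqr_ge0.
have ud0 : 0 <= u / d by rewrite divr_ge0.
have cos6 : cos (pi / 6) <= u / d.
  rewrite ler_pdivlMr // -ler_sqr ?nnegrE ?mulr_ge0 ?(ltW (cos_pi6_gt0 R)) //.
  have c2 : 4 * cos (pi / 6 : R) ^+ 2 = 3 by rewrite -r2 /sqrt3; ring.
  by rewrite exprMn hd; nra.
pose t := acos (u / d).
have t1 : -1 <= u / d <= 1 by rewrite ud andbT; lra.
have ct : cos t = u / d by apply: acosK; rewrite in_itv.
have t0 : 0 <= t by exact: acos_ge0.
have tp : t <= pi by exact: acos_lepi.
have st : sin t = w / d.
  apply/eqP; rewrite -(@eqrXn2 _ 2) // ?divr_ge0 //; last first.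
    by apply: sin_ge0_pi; rewrite t0.
  rewrite sin2cos2 ct !expr_div_n; apply/eqP.
  have d2 : d ^+ 2 != 0 by rewrite expf_eq0.
  by apply: (mulIf d2); rewrite mulrBl !divfK // mul1r hd; ring.
have t6 : t <= pi / 6.
  rewrite leNgt -ltr_cos ?ct -?leNgt //; rewrite in_itv /= ?t0 ?tp //.
  by apply/andP; split; lra.
exists d, t; split=> //.
- by rewrite d0.
- by rewrite t0.
- by rewrite ct mulrC divfK.
- by rewrite st mulrC divfK.
Qed.

Definition move_frame (P c : R * R) (d : R) (x : R * R) : R * R :=
  (c.1 + ((x.1 - P.1) * cos d - (x.2 - P.2) * sin d),
   c.2 + ((x.1 - P.1) * sin d + (x.2 - P.2) * cos d)).

Lemma move_frame_isometry P c d : plane_isometry (move_frame P c d).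
Proof.
move=> p q; rewrite /eucl_dist /move_frame /=; congr Num.sqrt.
transitivity (((p.1 - q.1) ^+ 2 + (p.2 - q.2) ^+ 2) * (cos d ^+ 2 + sin d ^+ 2)); first by ring.
by rewrite cos2Dsin2 mulr1.
Qed.

Lemma move_frame_sector P c mu theta v : in_sector P mu 1 v ->
  sector c theta (pi / 6) 1 (move_frame P c (theta - mu) v).
Proof.
move=> /in_sector_polar[rho [t [h1 h2 h3 h4]]]; exists rho, t; split=> //.
set u := dot_dir mu v - _ in h3; set w := _ - dot_dir (mu + pi / 2) P in h4.
have e1 : v.1 - P.1 = u * cos mu - w * sin mu.
  rewrite -[LHS]mulr1 -(cos2Dsin2 mu) /u /w /dot_dir cosDpihalf sinDpihalf; ring.
have e2 : v.2 - P.2 = u * sin mu + w * cos mu.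
  rewrite -[LHS]mulr1 -(cos2Dsin2 mu) /u /w /dot_dir cosDpihalf sinDpihalf; ring.
have et : theta = mu + (theta - mu) by ring.
have ct : cos theta = cos mu * cos (theta - mu) - sin mu * sin (theta - mu).
  by rewrite -cosD -et.
have st : sin theta = sin mu * cos (theta - mu) + cos mu * sin (theta - mu).
  by rewrite -sinD -et.
rewrite /move_frame e1 e2 h3 h4 (cosD theta t) (sinD theta t) ct st.
by congr (_ , _); ring.
Qed.

End Placement.

(** * Compactness of the set of placements *)

Section Compactness.
Variable R : realType.

Lemma continuous_dot_dir (v : R * R) (a : R) :
  continuous (fun z : R * R * R => dot_dir (z.2 + a) v - dot_dir (z.2 + a) z.1).
Proof.
move=> z.
have f1 : (fun z : R * R * R => z.1.1) @ z --> z.1.1.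
  by apply: (cvg_comp _ _ cvg_fst); exact: cvg_fst.
have f2 : (fun z : R * R * R => z.1.2) @ z --> z.1.2.
  by apply: (cvg_comp _ _ cvg_fst); exact: cvg_snd.
have f3 : (fun z : R * R * R => z.2 + a) @ z --> z.2 + a.
  by apply: cvgD; [exact: cvg_snd|exact: cvg_cst].
have c : (fun z : R * R * R => cos (z.2 + a)) @ z --> cos (z.2 + a).
  by apply: (cvg_comp _ _ f3); exact: continuous_cos.
have s : (fun z : R * R * R => sin (z.2 + a)) @ z --> sin (z.2 + a).
  by apply: (cvg_comp _ _ f3); exact: continuous_sin.
rewrite /dot_dir.
by apply: cvgB; apply: cvgD; apply: cvgM => //; exact: cvg_cst.
Qed.

Lemma closed_in_sector (v : R * R) :
  closed [set z : R * R * R | in_sector z.1 z.2 1 v].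
Proof.
have cl (f : R * R * R -> R) (b : R) : continuous f -> closed [set z | f z <= b].
  by move=> cf; exact: ((continuous_closedP f).1 cf [set x | x <= b] (@closed_le _ b)).
have -> : [set z : R * R * R | in_sector z.1 z.2 1 v] =
  [set z | dot_dir (z.2 + - (pi / 2)) v - dot_dir (z.2 + - (pi / 2)) z.1 <= 0]
  `&` [set z | dot_dir (z.2 + 2 * pi / 3) v - dot_dir (z.2 + 2 * pi / 3) z.1 <= 0]
  `&` [set z : R * R * R | (v.1 - z.1.1) ^+ 2 + (v.2 - z.1.2) ^+ 2 <= 1].
  have le1 (z : R * R * R) :
      (dist2 v z.1 <= 1) = ((v.1 - z.1.1) ^+ 2 + (v.2 - z.1.2) ^+ 2 <= 1).
    by rewrite -norm2_sq -[LHS]ler_sqr ?nnegrE ?dist2_ge0 // expr1n.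
  apply/seteqP; split => z /=; rewrite /in_sector !subr_le0 le1.
    by move=> [].
  by move=> [[]].
apply: closedI; first apply: closedI; apply: cl; try exact: continuous_dot_dir.
move=> z.
have f1 : (fun z : R * R * R => z.1.1) @ z --> z.1.1.
  by apply: (cvg_comp _ _ cvg_fst); exact: cvg_fst.
have f2 : (fun z : R * R * R => z.1.2) @ z --> z.1.2.
  by apply: (cvg_comp _ _ cvg_fst); exact: cvg_snd.
have g1 : (fun z : R * R * R => v.1 - z.1.1) @ z --> v.1 - z.1.1.
  by apply: cvgB => //; exact: cvg_cst.
have g2 : (fun z : R * R * R => v.2 - z.1.2) @ z --> v.2 - z.1.2.
  by apply: cvgB => //; exact: cvg_cst.
by under eq_fun do rewrite !expr2; apply: cvgD; apply: cvgM.
Qed.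

(** The bounds on [z] keep the placements in a box depending only on [gamma 0]. *)
Lemma grid_fits (gamma : R -> R * R) (D : seq R) :
  curve_length 0 1 gamma = 1%:E -> {subset D <= `[0, 1]} ->
  exists z : R * R * R,
    [/\ dist2 (gamma 0) z.1 <= 1, 0 <= z.2 <= 2 * pi &
        forall t, t \in D -> in_sector z.1 z.2 1 (gamma t)].
Proof.
move=> len D01.
(* A partition omits 0 and ends at 1, so only the interior points of [D] are sorted and 1 is
   appended. *)
pose l' := sort <=%R (undup [seq x <- D | 0 < x < 1]); pose l := rcons l' 1.
have l'01 x : x \in l' -> 0 < x < 1.
  by rewrite mem_sort mem_undup mem_filter => /andP[].
have sl : path <%R 0 (rcons l' 1).
  have : sorted <%R l' by rewrite lt_sorted_uniq_le sort_uniq undup_uniq sort_le_sorted.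
  move=> srt; rewrite rcons_path path_sortedE; last exact: lt_trans.
  rewrite srt andbT; apply/andP; split.
    by apply/allP => x /l'01 /andP[].
  have := mem_last 0 l'; rewrite inE => /predU1P[->|/l'01 /andP[]//].
  exact: ltr01.
have part : itv_partition 0 1 l by split => //; rewrite last_rcons.
pose s := map gamma (0 :: l).
have ps : polyline s <= 1.
  have : ((curve_variation 0 1 gamma l)%:E <= curve_length 0 1 gamma)%E.
    by apply: ereal_sup_ubound; exists (curve_variation 0 1 gamma l) => //; exists l.
  rewrite len lee_fin; apply: le_trans; rewrite /s /= /polyline polyline_fromE.
  rewrite /curve_variation size_map big_mkord le_eqVlt; apply/orP; left; apply/eqP.
  apply: eq_bigr => k _; rewrite -[_ :: _]/(map gamma (0 :: l)).
  rewrite !(nth_map 1) ?[size (_ :: _)]/= ?ltnS // ?(ltnW (ltn_ord k)) //.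
  by rewrite dist2C.
have [P [mu fit]] := finite_fits s.
have fit1 v : v \in s -> in_sector P mu 1 v.
  by move=> /fit[h1 h2 h3]; split=> //; apply: le_trans ps.
have [m /andP[m1 m2]] := turn_into (pi_gt0 R) mu 0.
exists (P, mu + 2 * pi * m%:~R); split => /=.
- by have [_ _ h] := fit1 (gamma 0) (mem_head _ _); exact: h.
- by rewrite m1 /=; apply: ltW; rewrite add0r in m2.
move=> t tD; have : gamma t \in s.
  apply: map_f; rewrite inE mem_rcons inE mem_sort mem_undup mem_filter tD andbT.
  have := D01 t tD; rewrite in_itv /= => /andP[h0 h1].
  have [//|t0] := eqVneq t 0; have [|t1] := eqVneq t 1; rewrite ?orbT //=.
  by rewrite !lt_neqAle h0 h1 eq_sym t0 t1.
move=> /fit1[h1 h2 h3]; split => //=.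
- by rewrite addrAC !dot_dir_turns.
- by rewrite addrAC !dot_dir_turns.
Qed.

(** The placements suitable for one point form a closed set; finitely many of these sets meet inside
    the compact [K], hence all of them do. *)
Lemma arc_fits (gamma : R -> R * R) : curve_length 0 1 gamma = 1%:E ->
  exists P mu, forall t, 0 <= t <= 1 -> in_sector P mu 1 (gamma t).
Proof.
move=> len.
pose g0 := gamma 0; pose I01 := [set t : R | 0 <= t <= 1].
pose K : set (R * R * R) :=
  (`[g0.1 - 1, g0.1 + 1] `*` `[g0.2 - 1, g0.2 + 1]) `*` `[0, 2 * pi].
have Kc : compact K by apply: compact_setX; [apply: compact_setX|]; exact: segment_compact.
pose f (t : R) := K `&` [set z : R * R * R | in_sector z.1 z.2 1 (gamma t)].
have fin : finI I01 f.
  move=> D DI; have [|z [z0 z1 z2]] := @grid_fits gamma (finmap.enum_fset D) len.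
    by move=> t /DI; rewrite in_setE in_itv.
  exists z => t tD; split; last exact: z2.
  have [x1 x2] : `|g0.1 - z.1.1| <= 1 /\ `|g0.2 - z.1.2| <= 1.
    by split; apply: le_trans z0; rewrite -sqrtr_sqr ler_wsqrtr // ?lerDl ?lerDr sqr_ge0.
  move: x1 x2; rewrite !ler_norml => /andP[x1 x2] /andP[x3 x4].
  by split => /=; [split|]; rewrite /= in_itv //=; apply/andP; split; lra.
have PF := finI_filter fin.
have ff t : I01 t -> filter_from (finI_from I01 f) id (f t).
  by move=> ht; exists (f t) => //; exact: finI_from1.
have [|z [_ zcl]] := Kc _ PF.
  by apply: filterS (ff 0 _) => [z []//|]; rewrite /I01 /= lexx ler01.
exists z.1, z.2 => t ht; apply: (@closed_in_sector (gamma t) z) => B.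
by apply: zcl; apply: filterS (ff t ht) => w [].
Qed.

End Compactness.

Theorem theorem3 (R : realType) (c : R * R) (theta : R) (A : set (R * R)) :
  unit_arc A ->
  exists T : R * R -> R * R,
    plane_isometry T /\ T @` A `<=` sector c theta (pi / 6) 1.
Proof.
move=> [gamma [_ len ->]]; have [P [mu fit]] := arc_fits len.
exists (move_frame P c (theta - mu)); split; first exact: move_frame_isometry.
move=> _ [_ [t t01 <-] <-]; apply: move_frame_sector; apply: fit.
by move: t01; rewrite /= in_itv.
Qed.
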